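(* Let $k$ be a fixed positive integer. Let $p$ be a prime, $T$ a positive divisor of $p-1$, and $\lambda\in\mathbb{Z}_p$ an element of multiplicative order $T$ modulo $p$. Let $a$ be an integer coprime to $p$, let $\mathcal{X},\mathcal{Y}$ be arbitrary subsets of the residue ring $\mathbb{Z}_{p-1}$, and let $\gamma(n)$ be arbitrary complex numbers with $|\gamma(n)|\le 1$. Define $$W_a(\gamma;T;\mathcal{X},\mathcal{Y})=\sum_{x\in\mathcal{X}}\Big|\sum_{y\in\mathcal{Y}}\gamma(y)\,\mathbf{e}_p(a\lambda^{xy})\Big|.$$ Then $$W_a(\gamma;T;\mathcal{X},\mathcal{Y})\ll \frac{|\mathcal{X}|^{1-\frac{1}{2k}}\,|\mathcal{Y}|^{1-\frac{1}{2k+2}}\,p^{\frac{1}{2k}+\frac{3}{4k+4}+o(1)}}{T^{\frac{1}{2k+2}}},$$ where the implied constant and the $o(1)$ term (as $p\to\infty$) depend only on $k$, uniformly in $T,\lambda,a,\mathcal{X},\mathcal{Y},\gamma$.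
   Context: For a positive integer $m$, $\mathbb{Z}_m=\{0,1,\dots,m-1\}$ denotes the residue ring modulo $m$, and $\mathbf{e}_m(z)=\exp(2\pi i z/m)$. Since $\lambda$ has order $T\mid p-1$, $\lambda^{xy}$ is well defined for $x,y\in\mathbb{Z}_{p-1}$. $|\mathcal{X}|,|\mathcal{Y}|$ denote cardinalities. The notation $A\ll B$ means $|A|\le cB$ for a constant $c$. *)

(* Defs.v *)
From HB Require Import structures.
From mathcomp Require Import all_boot all_order all_algebra.
From mathcomp Require Import all_classical all_reals all_analysis.
From mathcomp Require Export complex.

Set Implicit Arguments.
Unset Strict Implicit.
Unset Printing Implicit Defensive.

Import Order.TTheory GRing.Theory Num.Theory.

Local Open Scope ring_scope.

(* exp(2 pi i z / m), with exp(i t) = cos t + i sin t for real t. *)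
Definition e_ (R : realType) (m : nat) (z : int) : R[i] :=
  let t : R := 2 * pi * z%:~R / m%:R in (cos t +i* sin t)%C.

(* Z_(p-1) is 'I_(p.-1): the ring type 'Z_(p.-1) would be wrong for p = 2.
   Elements of 'F_p and 'I_(p.-1) enter the phase as their representatives,
   natural numbers in [0, p) (for p prime) and in [0, p - 1). *)
Definition W (R : realType) (p : nat) (a : int) (lambda : 'F_p)
    (gamma : 'I_p.-1 -> R[i]) (X Y : {set 'I_p.-1}) : R :=
  \sum_(x in X) Normc.normc
    (\sum_(y in Y)
       gamma y * e_ R p (a * (nat_of_ord lambda)%:Z ^+ (x * y)%N)).

(* Main.v *)
Require Import Defs.
From HB Require Import structures.
From mathcomp Require Import all_boot all_order all_algebra all_field cyclic.
From mathcomp Require Import all_classical all_reals all_analysis.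
From mathcomp Require Import ring lra zify.

(* Split Y according to d = gcd(y, p - 1). The units r of Z_(p-1) permute the
   y with a given d transitively, so averaging over r replaces Y by sets U_r of
   those y for which r y mod (p - 1) lies in a short interval [1, h]. By
   Hoelder and completion of the sum over x (where x -> r x is a bijection),
   each U_r leads to a 2k-th moment, which expands into complete sums of
   e_p(a P(z)) with P a sum of 2k monomials of degree at most h (p - 1) / T:
   the diagonal terms contribute k^k p |U_r|^k and Weil's bound controls the
   others. The choice h ~ nu^2 p / |Y| with nu^(2k+2) = |Y| T / p^(3/2)
   balances both contributions. The losses are numbers of divisors and of
   smooth numbers, which are p^o(1).

   Weil's bound is proved by Stepanov's method. For monic g put
   lam(g) = psi(sum of f over the roots of g). The generating function of
   the sums of lam(g) over the g of degree n is a polynomial of degree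
   < deg f, so that weighted sums of lam over the irreducible g of degree dividing
   n are, up to sign, power sums of at most deg f - 1 complex numbers omega.
   An auxiliary polynomial of small degree, divisible by every irreducible g
   with a given trace, bounds these sums, on average over the characters
   and for even n, by O(q^(n/2)), whence |omega| <= sqrt q. *)

Set Implicit Arguments.
Unset Strict Implicit.
Unset Printing Implicit Defensive.

Import Order.TTheory GRing.Theory Num.Theory.
Import numFieldNormedType.Exports.

Local Open Scope ring_scope.

(** * Power sums of the roots of a polynomial *)

(* The sizes are generalised because [lia] compares atoms syntactically, and
   the canonical structures inferred in [size p] vary. *)
Ltac slia :=
  repeat match goal with
  | H : is_true (leq _ _) |- _ => revert H | H : @eq nat _ _ |- _ => revert H end;
  repeat match goal with |- context [@size ?T ?p] =>
    let n := fresh "n" in move: (@size T p) => n end; clear; lia.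

(** With [lam = g ^ D] and D = (p - 1) / T, the terms are monomials in [g ^ x] of degree [D * y],
    and Weil's bound is empty once the degree exceeds sqrt p; the multiplication by r serves to
    lower these degrees. Up to the losses, an average U_r has |Y| h / p = nu^2 elements, so the
    diagonal, with 2k-th root p^(1/2k) |U_r|^(1/2), saves a factor nu over the trivial p^(1/2k)
    |U_r|. Weil's term saves the same factor exactly when (p / T) h p^(1/2) = p / nu^(2k), which is
    the equation for nu. If nu^2 <= k the trivial bound suffices; otherwise all size conditions on
    k, h and the degrees follow.

    Stepanov's method bounds the number of points with a given trace only from above; as the numbers
    for all traces add up to q^n, lower bounds follow. By orthogonality the number for trace 0 gives
    the sum over all nontrivial characters, in which all omegas enter with the same sign, so that
    none can hide. For even n, x -> x^(q^(n/2)) is an involution of the field with q^n elements, and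
    it exchanges the two halves of the trace. *)

Section PowerSums.
Variable K : fieldType.
Implicit Types (f g h : {poly K}) (N n : nat) (b c : K).

(* For monic [g], [g' / g] is the series of the power sums of the roots of [g]
   in powers of [1 / X]: the coefficient of ['X^(N - k)] below is the sum of
   the [k]-th powers of the roots. *)
Definition power_sums N g : {poly K} := ('X^(N.+1) * g^`()) %/ g.

Lemma power_sums_eq N g s r :
  'X^(N.+1) * g^`() = s * g + r -> (size r < size g)%N -> power_sums N g = s.
Proof. by move=> e sr; rewrite /power_sums e divp_addl_mul_small. Qed.

Lemma power_sums_eqr N g : g != 0 ->
  exists2 r : {poly K}, 'X^(N.+1) * g^`() = power_sums N g * g + r & (size r < size g)%N.
Proof.
move=> g0; exists (('X^(N.+1) * g^`()) %% g); first exact: divp_eq.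
exact: ltn_modpN0.
Qed.

Lemma power_sumsM N g h : g != 0 -> h != 0 ->
  power_sums N (g * h) = power_sums N g + power_sums N h.
Proof.
move=> g0 h0.
have [r er sr] := power_sums_eqr N g0; have [t et st] := power_sums_eqr N h0.
apply: (@power_sums_eq _ _ _ (r * h + t * g)).
  by rewrite derivM mulrDr mulrA er (mulrCA _ g) et; ring.
have g1 : (0 < size g)%N by rewrite size_poly_gt0.
have h1 : (0 < size h)%N by rewrite size_poly_gt0.
rewrite (leq_ltn_trans (size_polyD _ _)) // gtn_max (size_mul g0 h0).
have := size_polyMleq r h; have := size_polyMleq t g; slia.
Qed.

Lemma power_sums_XsubC N b :
  power_sums N ('X - b%:P) = \sum_(i < N.+1) (b ^+ i)%:P * 'X^(N - i).
Proof.
apply: (@power_sums_eq _ _ _ (b ^+ N.+1)%:P).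
  rewrite derivXsubC mulr1 -[LHS](subrK ((b ^+ N.+1)%:P)); congr (_ + _).
  rewrite rmorphXn /= subrXX mulrC; congr (_ * _).
  by apply: eq_bigr => i _; rewrite rmorphXn /= mulrC.
by rewrite size_XsubC (leq_ltn_trans (size_polyC_leq1 _)).
Qed.

Lemma size_power_sums N g : (size (power_sums N g) <= N.+1)%N.
Proof.
have [->|g0] := eqVneq g 0; first by rewrite /power_sums divp0 size_poly0.
rewrite /power_sums size_divp //.
have := size_polyMleq 'X^(N.+1) g^`(); rewrite size_polyXn.
have [->|g'0] := eqVneq g^`() 0; first by rewrite mulr0 size_poly0; lia.
have := lt_size_deriv g0; slia.
Qed.

(** By Newton's identities the power sums of index below [N] do not see the coefficient of
    ['X^(n - N)], and the [N]-th one contains it with factor [- N]. The proof checks directly that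
    the expected quotient leaves a remainder of degree below [n]. *)
Lemma power_sums_perturb N g n c : (0 < N)%N -> (N <= n)%N ->
  g \is monic -> size g = n.+1 ->
  power_sums N (g + c *: 'X^(n - N)) = power_sums N g - (c *+ N)%:P.
Proof.
move=> N0 Nn mg sg; have g0 : g != 0 by rewrite -size_poly_eq0 sg.
have := size_power_sums N g.
have [r e] := power_sums_eqr N g0.
move: (power_sums N g) e => s e; rewrite sg => sr ss.
have gn : g`_n = 1 by move/monicP: mg; rewrite lead_coefE sg.
(* Coefficient [N] holds the zeroth power sum, which counts the roots. *)
have sN : s`_N = n%:R.
  have : ('X^(N.+1) * g^`())`_(N + n) = (s * g + r)`_(N + n) by rewrite e.
  rewrite coefXnM ifN; last by lia.
  rewrite [(_ - _)%N](_ : _ = n.-1); last lia.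
  rewrite coef_deriv prednK ?gn; last lia.
  rewrite coefD (nth_default _ (s := r)) ?addr0; last lia.
  rewrite coefM (bigD1 (inord N)) //= inordK; last lia.
  rewrite addKn gn mulr1 big1 ?addr0 => [->//|i iN].
  case: (ltnP N i) => Ni; first by rewrite (nth_default _ (s := s)) ?mul0r // (leq_trans ss).
  have : (i < N)%N.
    rewrite ltn_neqAle Ni andbT; apply: contraNneq iN => iN'.
    by apply/eqP/val_inj; rewrite /= inordK ?iN' //; lia.
  by move=> iN'; rewrite (nth_default _ (s := g)) ?mulr0 // sg; lia.
apply: (@power_sums_eq _ _ _
  ('X^(N.+1) * (g + c *: 'X^(n - N))^`() - (s - (c *+ N)%:P) * (g + c *: 'X^(n - N)))).
  by rewrite [RHS]addrC subrK.
have sgc : size (g + c *: 'X^(n - N)) = n.+1.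
  rewrite size_polyDl // sg; have := size_scale_leq c ('X^(n - N) : {poly K}).
  by rewrite size_polyXn; slia.
rewrite sgc; apply/leq_sizeP => j nj.
rewrite derivD mulrDr e derivZ derivXn.
rewrite (_ : 'X^(N.+1) * (c *: ('X^((n - N).-1) *+ (n - N))) = (c *+ (n - N)) *: 'X^n); last first.
  case: (ltnP N n) => Nn'; last first.
    by rewrite [(n - N)%N](_ : _ = 0)%N ?mulr0n ?scale0r ?scaler0 ?mulr0 //; lia.
  rewrite -scalerAr mulrnAr -exprD [(N.+1 + _)%N](_ : _ = n) //; last lia.
  by rewrite -scalerMnr scalerMnl.
rewrite (_ : _ + _ - _ = r + (c *+ (n - N)) *: 'X^n - c *: (s * 'X^(n - N))
   + (c *+ N) *: g + (c * c *+ N) *: 'X^(n - N)); last first.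
  rewrite -!mul_polyC !rmorphMn /= rmorphM /=.
  set C := c%:P; set m := (n - N)%N; set Y := 'X^m; set Z := 'X^n.
  rewrite -(mulr_natr (C * C) N) -(mulr_natr C N) -(mulr_natr C m); ring.
have rj : r`_j = 0 by rewrite nth_default // (leq_trans _ nj).
have jnN : (j == n - N)%N = false by apply/negbTE/eqP; lia.
rewrite !coefD coefN !coefZ !coefXn coefMXn rj jnN mulr0 addr0 add0r ifN; last by lia.
(* In degree [n] the contributions [c (n - N)], [- c n] and [c N] cancel; above it everything
   vanishes for reasons of degree. *)
have [->|jn] := eqVneq j n.
  by rewrite gn subKn // sN !mulr1 mulrnBr // mulr_natr; ring.
have gj : g`_j = 0 by rewrite nth_default // sg; lia.
have sj : s`_(j - (n - N)) = 0.
  by rewrite nth_default // (leq_trans ss) //; lia.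
by rewrite gj sj !mulr0 subr0 addr0.
Qed.

(** The sum of [f] over the roots of [g] with multiplicity, written through coefficients so that it
    lies in [K] without a splitting field. *)
Definition weighted_power_sum f g : K :=
  \sum_(k < size f) f`_k * (power_sums (size f).-1 g)`_((size f).-1 - k).

Lemma weighted_power_sumM f g h : g != 0 -> h != 0 ->
  weighted_power_sum f (g * h) = weighted_power_sum f g + weighted_power_sum f h.
Proof.
move=> g0 h0; rewrite /weighted_power_sum -big_split /=; apply: eq_bigr => k _.
by rewrite power_sumsM // coefD mulrDr.
Qed.

Lemma weighted_power_sum_XsubC f b : weighted_power_sum f ('X - b%:P) = f.[b].
Proof.
rewrite horner_coef; apply: eq_bigr => k _; congr (_ * _).
rewrite power_sums_XsubC coef_sum.
have k0 : (k < (size f).-1.+1)%N by have := ltn_ord k; lia.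
rewrite (bigD1 (Ordinal k0)) //= coefCM coefXn eqxx mulr1 big1 ?addr0 // => i ik.
rewrite coefCM coefXn; case: eqP => [e|]; rewrite ?mulr0 //.
move/eqP: ik; case; apply: val_inj => /=.
move: e (ltn_ord i) (ltn_ord k).
by move: (nat_of_ord i) (nat_of_ord k) => a e; move: (size f) => m; lia.
Qed.

Lemma weighted_power_sum1 f : weighted_power_sum f 1 = 0.
Proof.
rewrite /weighted_power_sum big1 // => k _; rewrite /power_sums derivC mulr0 div0p.
by rewrite coef0 mulr0.
Qed.

Lemma weighted_power_sum_prod f (s : seq K) :
  weighted_power_sum f (\prod_(b <- s) ('X - b%:P)) = \sum_(b <- s) f.[b].
Proof.
elim: s => [|b s IH]; first by rewrite !big_nil weighted_power_sum1.
rewrite !big_cons weighted_power_sumM ?polyXsubC_eq0 ?IH ?weighted_power_sum_XsubC //.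
by rewrite monic_neq0 // monic_prod_XsubC.
Qed.

(** Only the leading term of [f] meets the power sum that moves. This shift is what makes the
    character sums over monic polynomials of degree at least [d] vanish. *)
Lemma weighted_power_sum_perturb f g d n c :
  size f = d.+1 -> (0 < d)%N -> (d <= n)%N -> g \is monic -> size g = n.+1 ->
  weighted_power_sum f (g + c *: 'X^(n - d))
    = weighted_power_sum f g - lead_coef f * (c *+ d).
Proof.
move=> sf d0 dn mg sg; rewrite /weighted_power_sum lead_coefE sf /=.
rewrite power_sums_perturb // !big_ord_recr /= subnn coefB coefC eqxx mulrBr addrA.
congr (_ + _ - _); apply: eq_bigr => k _; congr (_ * _).
by rewrite coefB coefC; case: eqP => [|_]; rewrite ?subr0 //; have := ltn_ord k; lia.
Qed.

End PowerSums.

(** Euclidean division commutes with extension of scalars; hence the sum can be computed in a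
    residue field, where the polynomial splits. *)
Lemma map_weighted_power_sum (K L : fieldType) (u : {rmorphism K -> L}) (f g : {poly K}) :
  u (weighted_power_sum f g) = weighted_power_sum (map_poly u f) (map_poly u g).
Proof.
rewrite /weighted_power_sum rmorph_sum size_map_poly; apply: eq_bigr => k _ /=.
rewrite rmorphM /= -!coef_map /= /power_sums map_divp rmorphM /=.
by rewrite map_polyXn deriv_map.
Qed.

(** * Sums over monic polynomials *)

Section Monics.
Variable F : finFieldType.
Implicit Types (g h P : {poly F}) (m n r : nat).

Lemma size_expS P m r : size P = m.+1 -> size (P ^+ r) = (m * r).+1.
Proof.
move=> sP; have P0 : P != 0 by rewrite -size_poly_eq0 sP.
by rewrite -[LHS]prednK ?size_poly_gt0 ?expf_neq0 // size_exp sP.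
Qed.

Definition monics n : seq {poly F} :=
  [seq 'X^n + \val p | p <- enum {poly_n F}].

Lemma mem_monics n g : (g \in monics n) = (g \is monic) && (size g == n.+1).
Proof.
apply/mapP/andP => [[p _ ->]|[/monicP mg /eqP sg]].
  have sp : (size (\val p) < size ('X^n : {poly F}))%N.
    by rewrite size_polyXn ltnS size_npoly.
  by rewrite monicE lead_coefDl // lead_coefXn size_polyDl // size_polyXn.
have sp : (size (g - 'X^n)%R <= n)%N.
  apply/leq_sizeP => j nj; rewrite coefB coefXn; case: eqP => [->|/eqP jn].
    by move: mg; rewrite lead_coefE sg /= => ->; rewrite subrr.
  by rewrite nth_default ?subrr // sg; lia.
by exists (NPoly sp); rewrite ?mem_enum //= addrC subrK.
Qed.

Lemma monicsP n g : reflect (g \is monic /\ size g = n.+1) (g \in monics n).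
Proof. by rewrite mem_monics; apply: (iffP andP) => -[? /eqP]. Qed.

Lemma uniq_monics n : uniq (monics n).
Proof. by rewrite map_inj_uniq ?enum_uniq // => p q /addrI /val_inj. Qed.

Lemma size_monics n : size (monics n) = (#|F| ^ n)%N.
Proof. by rewrite size_map -cardE card_npoly. Qed.

Lemma monics0 : monics 0 = [:: 1].
Proof.
apply: perm_small_eq => //; apply: uniq_perm => // [|g]; first exact: uniq_monics.
rewrite mem_monics inE; apply/andP/eqP => [[/monicP mg /size_poly1P[c c0 e]]|->].
  by move: mg; rewrite e lead_coefC => ->.
by rewrite monic1 size_poly1.
Qed.

Lemma perm_monics1 : perm_eq (monics 1) [seq 'X - x%:P | x <- enum F].
Proof.
apply: uniq_perm => [||g]; first exact: uniq_monics.
  by rewrite map_inj_uniq ?enum_uniq // => x y /addrI /oppr_inj /polyC_inj.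
apply/monicsP/mapP => [[/monicP mg sg]|[x _ ->]]; last first.
  by rewrite monicXsubC size_XsubC.
exists (- g`_0); first by rewrite mem_enum.
move: mg; rewrite lead_coefE sg /= => g1.
apply/polyP => -[|[|i]]; rewrite coefB coefX coefC ?sub0r ?opprK ?subr0 //=.
by rewrite nth_default ?oppr0 //; slia.
Qed.

Definition irreducible_monics m :=
  [seq g <- monics m | `[< irreducible_poly g >]].

Lemma irreducible_monicsP m P :
  reflect [/\ P \is monic, size P = m.+1 & irreducible_poly P]
          (P \in irreducible_monics m).
Proof.
rewrite mem_filter; apply: (iffP andP) => [[/asboolP iP /monicsP[]]|[? ? ?]] //.
by split; [apply/asboolP | apply/monicsP].
Qed.

Lemma irreducible_monics_gt0 m P : P \in irreducible_monics m -> (0 < m)%N.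
Proof. by case/irreducible_monicsP => _ sP [+ _]; rewrite sP ltnS. Qed.

Lemma uniq_irreducible_monics m : uniq (irreducible_monics m).
Proof. by rewrite filter_uniq // uniq_monics. Qed.

Lemma exists_irreducible_factor n g : g \in monics n.+1 ->
  exists m P, P \in irreducible_monics m /\ P %| g.
Proof.
elim/ltn_ind: n g => n IH g /monicsP[mg sg].
have [ig|nig] := pselect (irreducible_poly g).
  by exists n.+1, g; split=> //; apply/irreducible_monicsP.
have g0 : g != 0 by rewrite -size_poly_eq0 sg.
have [q [q1 qg nq]] : exists q : {poly F}, [/\ size q != 1%N, q %| g & ~~ (q %= g)].
  apply: contrapT => nex; apply: nig; split=> [|q q1 qg]; first by rewrite sg.
  by apply: contrapT => /negP nq; apply: nex; exists q.
have q0 : q != 0 by apply: contraTneq qg => ->; rewrite dvd0p.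
have sq : (size q < size g)%N.
  by rewrite ltn_neqAle dvdp_leq // andbT dvdp_size_eqp.
have lq : lead_coef q != 0 by rewrite lead_coef_eq0.
pose q' := (lead_coef q)^-1 *: q.
have sq' : size q' = size q by rewrite size_scale // invr_eq0.
have q2 : (1 < size q)%N by move: q1 q0; rewrite -size_poly_gt0; case: (size q) => [|[]].
have [||m [P [iP Pq]]] := IH (size q).-2 _ q'; first by move: sq; rewrite sg; slia.
  apply/monicsP; rewrite sq' monicE lead_coefZ mulVf //; split=> //.
  by move: q2; slia.
exists m, P; split=> //; apply: dvdp_trans Pq _.
by rewrite dvdpZl // invr_eq0.
Qed.

Lemma irreducible_monics_coprime m m' P Q : P \in irreducible_monics m ->
  Q \in irreducible_monics m' -> P != Q -> coprimep P Q.
Proof.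
case/irreducible_monicsP => mP sP iP /irreducible_monicsP[mQ sQ iQ] PQ.
rewrite irreducible_poly_coprime //; apply: contra PQ => PQ.
rewrite -eqp_monic //; apply: apply_irredp => //.
by rewrite sP; case: iP; rewrite sP ltnS; case: (m).
Qed.

(** The multiplicity of [P] in [g] is the number of [r > 0] with [P ^+ r] dividing [g], so this is
    the degree of the factorisation of [g]. The cut-off [N] is separate from [n] because the
    induction lowers [n], and because one application ranges over more degrees. *)
Lemma degree_irreducible_factors N n g : g \in monics n -> (n <= N)%N ->
  n = (\sum_(1 <= m < N.+1) \sum_(P <- irreducible_monics m)
        \sum_(1 <= r < N.+1) ((P ^+ r)%R %| g)%R * m)%N.
Proof.
elim/ltn_ind: n g => -[|n] IH g gn nN.
  rewrite big1 // => m _; rewrite big_seq big1 // => P /[dup] Pm /irreducible_monicsP[mP sP iP].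
  have m0 := irreducible_monics_gt0 Pm.
  rewrite big_nat_cond big1 // => r /andP[/andP[r0 _] _]; move: gn.
  rewrite monics0 inE => /eqP ->; rewrite dvdp1 (size_expS _ sP).
  by rewrite eqSS muln_eq0 !eqn0Ngt m0 r0.
have [m0 [P0 [iP0 P0g]]] := exists_irreducible_factor gn.
have /irreducible_monicsP[mP0 sP0 irP0] := iP0.
have m00 := irreducible_monics_gt0 iP0.
have P00 : P0 != 0 by rewrite -size_poly_eq0 sP0.
have /monicsP[/monicP mg sg] := gn.
have g0 : g != 0 by rewrite -size_poly_eq0 sg.
have /dvdpP[h e] := P0g; rewrite mulrC in e.
have h0 : h != 0 by apply: contraNneq g0 => h0; rewrite e h0 mulr0.
have sh : (m0 + (size h).-1 = n.+1)%N.
  have := sg; rewrite e size_mul // sP0; move: h0; rewrite -size_poly_gt0; slia.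
have hm : h \in monics (size h).-1.
  apply/monicsP; split; last by rewrite prednK // size_poly_gt0.
  by rewrite monicE; have := mg; rewrite e lead_coefM (monicP mP0) mul1r => ->.
(* Dividing by [P0] lowers the multiplicity of [P0] by one and, by coprimality, changes no other. *)
have key m P : P \in irreducible_monics m ->
    (\sum_(1 <= r < N.+1) ((P ^+ r)%R %| g)%R * m =
     \sum_(1 <= r < N.+1) ((P ^+ r)%R %| h)%R * m + (P == P0) * m)%N.
  move=> iP; have [->|PP0] := eqVneq P P0; last first.
    rewrite mul0n addn0; apply: eq_bigr => r _; congr (nat_of_bool _ * _)%N.
    rewrite e Gauss_dvdpr // coprimep_expl //.
    by apply: (irreducible_monics_coprime iP iP0).
  rewrite -!big_distrl /= -mulnDl; congr (_ * _)%N.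
  clear IH; case: N nN => // N nN; rewrite [in RHS]big_nat_recr //=.
  have -> : (P0 ^+ N.+1 %| h) = false.
    apply/negbTE; apply: contraL nN => /(dvdp_leq h0).
    rewrite (size_expS _ sP0) => sN; rewrite -ltnNge ltnS.
    have := leq_pmull N.+1 m00; move: (m0 * N.+1)%N sN => u sN.
    by move: sh sN; slia.
  rewrite !big_add1 addn0 addn1 /= big_nat_recl // expr1 P0g add1n.
  by congr (_.+1); apply: eq_bigr => r _; rewrite e exprS dvdp_mul2l.
under eq_bigr => m _ do rewrite (eq_big_seq _ (key m)) big_split /=.
rewrite big_split /= -(IH (size h).-1) //; [|move: sh nN m00; slia..].
suff -> : (\sum_(1 <= m < N.+1) \sum_(P <- irreducible_monics m) (P == P0) * m = m0)%N.
  by move: sh; slia.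
rewrite (bigD1_seq m0) ?iota_uniq ?mem_index_iota //=; last first.
  by move: sh; slia.
rewrite (bigD1_seq P0) ?uniq_irreducible_monics //= eqxx mul1n.
rewrite big1 ?addn0 => [|P /negbTE->] //; rewrite big1 ?addn0 // => m mm0.
rewrite big_seq big1 // => P /irreducible_monicsP[_ sP _].
by case: eqP => // PP0; move: sP; rewrite PP0 sP0 => -[e']; rewrite e' eqxx in mm0.
Qed.

End Monics.

(** * Euler products and their logarithmic derivatives *)

Section EulerProduct.
Variables (F : finFieldType) (C : comNzRingType) (lam : {poly F} -> C).
Hypothesis lam1 : lam 1 = 1.
Hypothesis lamM : forall g h, g \is monic -> h \is monic ->
  lam (g * h) = lam g * lam h.

Definition monic_sum n : C := \sum_(g <- monics F n) lam g.

(* The sum of [lam] (of the minimal polynomial, to the power making up for the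
   degree) over the elements of the extension of degree [n] of [F]. *)
Definition point_sum n : C :=
  \sum_(1 <= m < n.+1 | (m %| n)%N)
     \sum_(P <- irreducible_monics F m) m%:R * lam P ^+ (n %/ m)%N.

Lemma lamX g r : g \is monic -> lam (g ^+ r) = lam g ^+ r.
Proof.
by move=> mg; elim: r => [|r IH]; rewrite ?expr0 // !exprS lamM ?monic_exp // IH.
Qed.

Lemma monic_sum0 : monic_sum 0 = 1.
Proof. by rewrite /monic_sum monics0 big_seq1. Qed.

Lemma monic_sum_multiples n m r P : P \in irreducible_monics F m ->
  \sum_(g <- monics F n | P ^+ r %| g) lam g =
  if (m * r <= n)%N then lam P ^+ r * monic_sum (n - m * r) else 0.
Proof.
move=> /irreducible_monicsP[mP sP _]; have sPr := size_expS r sP.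
have mPr : P ^+ r \is monic by rewrite monic_exp.
case: ifP => mrn; last first.
  rewrite big_seq_cond big1 // => g /andP[/monicsP[mg sg] /dvdp_leq].
  by move=> /(_ (monic_neq0 mg)); rewrite sg sPr ltnS mrn.
rewrite /monic_sum big_distrr /= -big_filter.
under [RHS]eq_big_seq => h /monicsP[mh _] do rewrite -lamX // -lamM //.
rewrite -(big_map (fun h => P ^+ r * h) predT lam); apply: perm_big.
have P0 : P ^+ r != 0 by rewrite monic_neq0.
apply: uniq_perm => [||g]; first by rewrite filter_uniq ?uniq_monics.
  by rewrite map_inj_uniq ?uniq_monics //; apply: mulfI.
rewrite mem_filter; apply/andP/mapP => [[/dvdpP[h e] /monicsP[mg sg]]|[h]].
  have h0 : h != 0.
    by apply: contraTneq mg => h0; rewrite e h0 mul0r monicE lead_coef0 eq_sym oner_eq0.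
  exists h; last by rewrite mulrC.
  apply/monicsP; split.
    by move: mg; rewrite e !monicE lead_coefM (monicP mPr) mulr1.
  move: sg; rewrite e size_mul // sPr; move: h0 mrn; rewrite -size_poly_gt0.
  by move: (m * r)%N; slia.
move=> /monicsP[mh sh] ->; split; first by rewrite dvdp_mulr.
apply/monicsP; split; first by rewrite monicMl.
have h0 : h != 0 by rewrite -size_poly_eq0 sh.
by rewrite size_mul // sPr sh; move: mrn; move: (m * r)%N; slia.
Qed.

Lemma big_nat_dvd m n (phi : nat -> nat -> C) : (0 < m)%N ->
  \sum_(1 <= r < n.+1 | (m * r <= n)%N) phi (m * r)%N r =
  \sum_(1 <= j < n.+1 | (m %| j)%N) phi j (j %/ m)%N.
Proof.
move=> m0; rewrite -big_filter -[RHS]big_filter.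
under eq_bigr => r _ do rewrite -[X in phi _ X](mulKn r m0).
rewrite -(big_map (fun r => (m * r)%N) predT (fun j => phi j (j %/ m)%N)).
apply: perm_big; apply: uniq_perm => [||j].
- rewrite map_inj_uniq ?filter_uniq ?iota_uniq // => a b /eqP.
  by rewrite eqn_pmul2l // => /eqP.
- by rewrite filter_uniq ?iota_uniq.
rewrite mem_filter mem_index_iota; apply/mapP/andP => [[r]|[/dvdnP[r e] jn]].
  rewrite mem_filter mem_index_iota => /andP[mrn /andP[r0 rn]] ->.
  by rewrite dvdn_mulr // muln_gt0 m0 r0 ltnS.
exists r; last by rewrite mulnC.
move: jn; rewrite mem_filter mem_index_iota e mulnC ltnS => /andP[mr0 mrn].
by rewrite mrn /=; move: mr0; rewrite muln_gt0 m0 /= => ->; rewrite ltnS (leq_trans _ mrn) // leq_pmull.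
Qed.

(** With L the generating function of [monic_sum], this is t L' = L (t L' / L). No power series are
    needed: the factor [n], the degree of each [g], is replaced by the sum over the prime powers
    dividing [g], and the [g] divisible by [P ^+ r], of degree [j], are grouped. *)
Lemma monic_sum_recurrence n :
  n%:R * monic_sum n = \sum_(1 <= j < n.+1) point_sum j * monic_sum (n - j).
Proof.
rewrite /monic_sum big_distrr /=.
under eq_big_seq => g gn.
  rewrite {1}(degree_irreducible_factors gn (leqnn n)) natr_sum big_distrl /=.
  under eq_bigr => m _.
    rewrite natr_sum big_distrl /=.
    under eq_bigr => P _ do rewrite natr_sum big_distrl /=.
    over.
  over.
rewrite exchange_big /=.
transitivity (\sum_(1 <= m < n.+1) \sum_(P <- irreducible_monics F m)
   \sum_(1 <= j < n.+1 | (m %| j)%N) m%:R * lam P ^+ (j %/ m) * monic_sum (n - j)).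
  apply: eq_big_seq => m; rewrite mem_index_iota => /andP[m0 _].
  rewrite exchange_big /=; apply: eq_big_seq => P Pm.
  rewrite exchange_big /=.
  rewrite -(big_nat_dvd n (fun j r => m%:R * lam P ^+ r * monic_sum (n - j)) m0).
  rewrite [RHS]big_mkcond /=; apply: eq_bigr => r _.
  transitivity (m%:R * \sum_(g <- monics F n | P ^+ r %| g) lam g).
    rewrite big_distrr [RHS]big_mkcond /=; apply: eq_bigr => g _.
    by case: (_ %| _); rewrite ?mul1n ?mul0n ?mul0r.
  rewrite (monic_sum_multiples _ _ Pm); case: ifP => _; last by rewrite mulr0.
  by rewrite mulrA.
transitivity (\sum_(1 <= m < n.+1) \sum_(1 <= j < n.+1 | (m %| j)%N)
   \sum_(P <- irreducible_monics F m) m%:R * lam P ^+ (j %/ m) * monic_sum (n - j)).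
  by apply: eq_bigr => m _; rewrite exchange_big.
rewrite (exchange_big_dep predT) //=; apply: eq_big_seq => j.
rewrite mem_index_iota => /andP[j0 jn].
rewrite /point_sum big_distrl /=.
rewrite [RHS](big_nat_widen _ _ n.+1) //=.
apply: eq_big => [m|m mj]; last by rewrite big_distrl.
by case: (boolP (m %| j)%N) => //= mj; rewrite ltnS dvdn_leq.
Qed.

Lemma point_sum1 : point_sum 1 = monic_sum 1.
Proof.
have := monic_sum_recurrence 1.
by rewrite big_nat1 subnn monic_sum0 mul1r mulr1.
Qed.

End EulerProduct.

(** * Stepanov's method *)

Lemma pnat_pchar_card (F : finFieldType) : [pchar F].-nat #|F|.
Proof.
have [p p_pr pF] := finPcharP F.
by rewrite (card_pprimeChar pF) pnatX pnatE // pF.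
Qed.

Section Frobenius.
Variables (F : finFieldType) (A : comNzRingType).
Hypothesis pcharA : [pchar A] =i [pchar F].

Lemma exprD_card i (x y : A) :
  (x + y) ^+ (#|F| ^ i) = x ^+ (#|F| ^ i) + y ^+ (#|F| ^ i).
Proof.
apply: exprDn_pchar; rewrite (eq_pnat _ pcharA) pnatX.
by rewrite pnat_pchar_card.
Qed.

Lemma expr_sum_card i (I : Type) (r : seq I) (Q : pred I) (E : I -> A) :
  (\sum_(j <- r | Q j) E j) ^+ (#|F| ^ i) = \sum_(j <- r | Q j) E j ^+ (#|F| ^ i).
Proof.
apply: (big_morph (fun x => x ^+ (#|F| ^ i))) => [x y|]; first exact: exprD_card.
by rewrite expr0n expn_eq0 gtn_eqF ?(ltnW (finNzRing_gt1 F)).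
Qed.
End Frobenius.

Lemma expf_cardX (F : finFieldType) i (c : F) : c ^+ (#|F| ^ i) = c.
Proof. by elim: i => [|i IH]; rewrite ?expr1 // expnS exprM expf_card. Qed.

Section Residue.
Variables (F : finFieldType) (L : fieldExtType F).
Local Notation q := #|F|.
Local Notation "p ^L" := (map_poly (in_alg L) p) (at level 2, format "p ^L").
Implicit Types (p f P : {poly F}) (x z : L).

Lemma expf_card_ext x : x ^+ (q ^ \dim {:L}) = x.
Proof.
have := expf_card (x : finvect_type L).
have := @card_vspace F (finvect_type L) _ {: finvect_type L}.
by rewrite card_vspacef => ->.
Qed.

Lemma expf_card_extM r x : x ^+ (q ^ (r * \dim {:L})) = x.
Proof.
elim: r => [|r IH]; first by rewrite mul0n.
by rewrite mulSn expnD exprM expf_card_ext.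
Qed.

Lemma card_ext : #|finvect_type L| = (q ^ \dim {:L})%N.
Proof.
by have := @card_vspace F (finvect_type L) _ {: finvect_type L}; rewrite card_vspacef.
Qed.

Lemma horner_expr_card p x i : p^L.[x ^+ (q ^ i)] = p^L.[x] ^+ (q ^ i).
Proof.
rewrite !horner_coef (expr_sum_card (pchar_lalg L)); apply: eq_bigr => j _.
by rewrite exprMn coef_map /= exprAC -[in RHS](rmorphXn (in_alg L)) expf_cardX.
Qed.

Variables (P : {poly F}) (m : nat) (z : L).
Hypotheses (Pm : P \in irreducible_monics F m) (dimL : \dim {:L} = m).
Hypotheses (Pz : root P^L z) (Lz : <<1; z>>%VS = fullv).

(** Otherwise the [t]-th iterate of Frobenius, with 0 < t < m, fixes the generator [z], hence all
    [q ^ m] elements of [L]: too many roots for ['X^(q ^ t) - 'X]. *)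
Lemma conjugates_inj i t : (t < m)%N -> z ^+ (q ^ i) = z ^+ (q ^ (i + t)) -> t = 0%N.
Proof.
move=> tm; rewrite addnC expnD exprM => zt; apply/eqP/negPn/negP; rewrite -lt0n => t0.
have {}zt : z ^+ (q ^ t) = z.
  apply/eqP; rewrite -subr_eq0; apply/eqP.
  have : (z ^+ (q ^ t) - z) ^+ (q ^ i) + z ^+ (q ^ i) = z ^+ (q ^ i).
    by rewrite -(exprD_card (pchar_lalg L)) subrK -zt.
  by move/(canRL (addrK _)); rewrite subrr => /eqP; rewrite expf_eq0 => /andP[_ /eqP].
have all_fixed x : x ^+ (q ^ t) = x.
  have : x \in <<1; z>>%VS by rewrite Lz memvf.
  case/Fadjoin_polyP => _ /polyOver1P[p ->] ->.
  by rewrite -horner_expr_card zt.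
pose T := finvect_type L.
have q1 : (1 < q)%N := finNzRing_gt1 F.
have qt1 : (1 < q ^ t)%N by rewrite -(expn0 q) ltn_exp2l.
have sX : size ('X^(q ^ t) - 'X : {poly T}) = (q ^ t).+1.
  by rewrite size_polyDl ?size_polyXn // size_polyN size_polyX.
have := @max_poly_roots T ('X^(q ^ t) - 'X) (enum T).
rewrite sX -cardE card_ext dimL ltnS leq_exp2l // enum_uniq -size_poly_eq0 sX leqNgt tm /=.
have -> : all (root ('X^(q ^ t) - 'X : {poly T})) (enum T).
  by apply/allP => x _; rewrite rootE !hornerE subr_eq0; apply/eqP/all_fixed.
by move=> /(_ isT isT isT).
Qed.

Lemma map_poly_irreducible_prod :
  P^L = \prod_(x <- mkseq (fun i => z ^+ (q ^ i)) m) ('X - x%:P).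
Proof.
have /irreducible_monicsP[mP sP iP] := Pm.
have -> : P^L = lead_coef P^L *: \prod_(x <- mkseq (fun i => z ^+ (q ^ i)) m) ('X - x%:P).
  apply: all_roots_prod_XsubC; first by rewrite size_map_poly size_mkseq.
    apply/allP => _ /mapP[i _ ->]; rewrite rootE horner_expr_card (eqP Pz).
    by rewrite expr0n expn_eq0 gtn_eqF ?(ltnW (finNzRing_gt1 F)).
  rewrite uniq_rootsE; apply/mkseq_uniqP => i j; rewrite !inE => im jm.
  wlog ij : i j im jm / (i <= j)%N.
    by move=> W e; case/orP: (leq_total i j) => ij; [|apply/esym]; apply: W.
  rewrite -(subnKC ij) => /conjugates_inj -> //; first by rewrite addn0.
  by rewrite (leq_ltn_trans _ jm) // leq_subr.
by rewrite lead_coef_map (monicP mP) rmorph1 scale1r.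
Qed.

(** The roots of [P] are the Frobenius conjugates of [z], so both sides are the trace of the value
    of [f] at [z]. *)
Lemma trace_eq f :
  in_alg L (weighted_power_sum f P) = \sum_(i < m) f^L.[z] ^+ (q ^ i).
Proof.
rewrite (map_weighted_power_sum (in_alg L)) map_poly_irreducible_prod.
rewrite weighted_power_sum_prod /mkseq big_map -(big_mkord xpredT (fun i => f^L.[z] ^+ (q ^ i))).
by rewrite /index_iota subn0; apply: eq_bigr => i _; rewrite horner_expr_card.
Qed.

(** This plays the part of the trace from the field of degree [r * m]: the [m] conjugates are met
    [r] times, and one never has to leave [L]. *)
Lemma sum_conjugates_mul f r :
  \sum_(i < r * m) f^L.[z] ^+ (q ^ i) = in_alg L (weighted_power_sum f P *+ r).
Proof.
elim: r => [|r IH]; first by rewrite big_ord0 mulr0n rmorph0.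
have -> : in_alg L (weighted_power_sum f P *+ r.+1) =
    in_alg L (weighted_power_sum f P *+ r) + in_alg L (weighted_power_sum f P).
  by rewrite mulrSr rmorphD.
rewrite trace_eq -IH mulSn addnC big_split_ord /=.
congr (_ + _); apply: eq_bigr => i _; rewrite expnD mulnC exprM -{2}dimL.
exact: expf_card_extM.
Qed.

End Residue.

Lemma exists_residue_field (F : finFieldType) P m : P \in irreducible_monics F m ->
  exists (L : fieldExtType F) (z : L),
    [/\ \dim {:L} = m, root (map_poly (in_alg L) P) z & <<1; z>>%VS = fullv].
Proof.
case/irreducible_monicsP => mP sP iP.
by have [L dL [z rz zL]] := irredp_FAdjoin iP; exists L, z; rewrite dL sP.
Qed.

Lemma exists_vanishing_combination (F : fieldType) (I : finType) (h : I -> {poly F}) B :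
  (forall i, size (h i) <= B)%N -> (B < #|I|)%N ->
  exists2 u : I -> F, exists i, u i != 0 & \sum_i u i *: h i = 0.
Proof.
move=> hB BI; pose A : 'M[F]_(#|I|, B) := \matrix_i poly_rV (h (enum_val i)).
have : kermx A != 0.
  by rewrite -mxrank_eq0 mxrank_ker subn_eq0 -ltnNge (leq_ltn_trans (rank_leq_col A)).
case/rowV0Pn => v /sub_kermxP vA v0; exists (fun i => v 0 (enum_rank i)).
  case/rV0Pn: v0 => j vj; exists (enum_val j); by rewrite enum_valK.
have := congr1 rVpoly vA; rewrite linear0 mulmx_sum_row linear_sum /=.
apply: etrans; rewrite (reindex_onto (@enum_val I predT) enum_rank) /=; last by move=> i _; rewrite enum_rankK.
apply: eq_big => [j|j _]; first by rewrite enum_valK eqxx.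
by rewrite enum_valK linearZ /= rowK poly_rV_K.
Qed.

(** Among the terms with nonzero coefficient, the one of largest size has a leading term that
    nothing cancels. *)
Lemma combination_neq0 (F : fieldType) (I : finType) (g : I -> {poly F}) (u : I -> F) :
  (forall i, 0 < size (g i))%N -> injective (fun i => size (g i)) ->
  (exists i, u i != 0) -> \sum_i u i *: g i != 0.
Proof.
move=> g0 ginj [i1 ui1].
case: (@arg_maxnP I i1 (fun i => u i != 0) (fun i => size (g i)) ui1) => i0 ui0 imax.
apply/eqP => /(congr1 (fun p : {poly F} => p`_(size (g i0)).-1)); rewrite coef0 coef_sum.
rewrite (bigD1 i0) //= big1 => [|i ii0].
  rewrite coefZ addr0 => /eqP; rewrite mulf_eq0 (negbTE ui0) /= -lead_coefE.
  by rewrite lead_coef_eq0 -size_poly_eq0 eqn0Ngt g0.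
have [->|ui] := eqVneq (u i) 0; first by rewrite scale0r coef0.
rewrite coefZ [X in _ * X]nth_default ?mulr0 // -ltnS prednK //.
rewrite ltn_neqAle (imax _ ui : (size (g i) <= size (g i0))%N) andbT; apply: contra ii0 => /eqP e; apply/eqP/ginj.
by rewrite /= e.
Qed.

Section Stepanov.
Variables (F : finFieldType) (f : {poly F}) (d : nat).
Hypotheses (sf : size f = d.+1) (d0 : (0 < d)%N) (dq : coprime d #|F|).
Local Notation q := #|F|.

(* The trace of [f] from the field with [q ^ n] elements to [F] is [w + w ^ Q]
   when [n = 2 s], [Q = q ^ s] and [w] is the following partial trace. *)
Definition half_trace s : {poly F} := \sum_(i < s) f ^+ (q ^ i).

Let q1 : (1 < q)%N := finNzRing_gt1 F.

Lemma size_half_trace s : size (half_trace s.+1) = (d * q ^ s).+1.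
Proof.
rewrite /half_trace; elim: s => [|s IH]; first by rewrite big_ord1 (size_expS _ sf).
rewrite big_ord_recr /= addrC size_polyDl (size_expS _ sf) //= IH ltnS ltn_pmul2l //.
by rewrite ltn_exp2l.
Qed.

Section Auxiliary.
Variable (s : nat) (e : F).
Local Notation l := (q ^ s)%N.
Local Notation Q := (q ^ s.+1)%N.
Local Notation w := (half_trace s.+1).
(** The ranges [l] and [q] of the first and last index let the degree of [g t] determine [t]; the
    range [l + d] makes the indices outnumber the dimension of the space containing the [h t]. *)
Local Notation I := ('I_l * 'I_(l + d) * 'I_q)%type.

(* A combination of the [h t] which vanishes makes the same combination [G] of
   the [g t] divisible by [P]: modulo [P], the [Q]-th power of ['X^Q] is ['X]
   and that of [w] is [e - w], so [G ^ Q] is the combination of the [h t]. *)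
Let g (t : I) : {poly F} := 'X^(t.1.1 + t.1.2 * Q) * w ^+ t.2.
Let h (t : I) : {poly F} := 'X^(t.1.1 * Q + t.1.2) * (e%:P - w) ^+ t.2.

Let l0 : (0 < l)%N.
Proof. by rewrite expn_gt0 (ltnW q1). Qed.

Lemma size_aux t : size (g t) = (t.1.1 + l * (t.1.2 * q + t.2 * d)).+1.
Proof.
have w0 : w ^+ t.2 != 0 by rewrite -size_poly_eq0 (size_expS _ (size_half_trace s)).
rewrite /g mulrC size_mulXn // (size_expS _ (size_half_trace s)) expnSr; lia.
Qed.

(** The degree [i + l * (j * q + k * d)] gives [i] modulo [l], then [k * d] modulo [q], hence [k] as
    [d] is coprime to [q], and finally [j]. *)
Lemma size_aux_inj : injective (fun t => size (g t)).
Proof.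
move=> [[i j] k] [[i' j'] k'] /=; rewrite !size_aux /= => -[e0].
have ii : i = i' :> nat.
  have := congr1 (modn^~ l) e0; rewrite !(addnC (nat_of_ord _)) !(mulnC l).
  by rewrite !modnMDl !modn_small.
move: e0; rewrite ii => /addnI /eqP; rewrite eqn_pmul2l // => /eqP e1.
have kk : k = k' :> nat.
  have : (k * d == k' * d %[mod q])%N.
    by have := congr1 (modn^~ q) e1; rewrite !modnMDl => ->.
  wlog kk' : k k' {e1} / (k' <= k)%N.
    move=> W; case/orP: (leq_total k k') => kk' E.
      by apply/esym; apply: W => //; rewrite eq_sym.
    exact: W.
  rewrite eqn_mod_dvd ?leq_mul // -mulnBl Gauss_dvdl; last by rewrite coprime_sym.
  have [k0 _|k0] := posnP (k - k')%N; last first.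
    move/(dvdn_leq k0); have := ltn_ord k; move: (nat_of_ord k) k0 => x; lia.
  by apply/eqP; rewrite eqn_leq kk' -subn_eq0 k0.
move: e1; rewrite kk => /addIn /eqP; rewrite eqn_pmul2r ?(ltnW q1) // => /eqP jj.
by congr (_, _, _); apply: val_inj.
Qed.

Lemma size_vanishing t : (size (h t) <= l.-1 * Q + (l + d) + q.-1 * (d * l))%N.
Proof.
rewrite /h; case: t => -[i j] k /=.
have sew : (size (e%:P - w)%R <= (d * l).+1)%N.
  rewrite (leq_trans (size_polyD _ _)) // size_polyN size_half_trace geq_max leqnn andbT.
  by rewrite (leq_trans (size_polyC_leq1 _)).
have sk : (size ((e%:P - w) ^+ k)%R <= (q.-1 * (d * l)).+1)%N.
  rewrite (leq_trans (size_poly_exp_leq _ _)) // ltnS mulnC leq_mul //.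
    by rewrite -ltnS prednK // (ltnW q1).
  by case: (size _) sew.
rewrite (leq_trans (size_polyMleq _ _)) // size_polyXn /=.
have ij : (i * Q + j < l.-1 * Q + (l + d))%N.
  rewrite -addnS leq_add ?ltn_ord // leq_mul2r; apply/orP; right.
  by rewrite -ltnS prednK.
move: (i * Q + j)%N (l.-1 * Q + (l + d))%N (q.-1 * (d * l))%N ij sk => a b c; slia.
Qed.

(** The right-hand side exceeds the left-hand side by [l * (q - 1) + d * (l - 1)]. *)
Lemma card_aux : (l.-1 * Q + (l + d) + q.-1 * (d * l) < #|{: I}|)%N.
Proof.
rewrite !card_prod !card_ord expnSr.
case: (l) l0 => // l' _ /=; move: q1 d0; case: q => // q' q1' d0' /=.
rewrite ltnS in q1'.
have : (0 < q' * l'.+1)%N by rewrite muln_gt0 q1'.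
nia.
Qed.

(** The term [q ^ (2 * s + 1)] is the expected number of elements of trace [e] among
    [q ^ (2 * s + 2)]. Simple vanishing of [G] is enough because its degree exceeds this number so
    little. *)
Lemma stepanov_auxiliary : exists2 G : {poly F}, G != 0 &
  ((size G).-1 <= q ^ (2 * s + 1) + 2 * (d * q ^ s.+1))%N
  /\ forall m P, P \in irreducible_monics F m -> (m %| 2 * s.+1)%N ->
     weighted_power_sum f P *+ (2 * s.+1 %/ m) = e -> P %| G.
Proof.
have [u u0 H0] := exists_vanishing_combination size_vanishing card_aux.
exists (\sum_t u t *: g t).
  by apply: combination_neq0 => // [t|]; [rewrite size_aux | exact: size_aux_inj].
split.
  suff : (size (\sum_t u t *: g t)%R <= (q ^ (2 * s + 1) + 2 * (d * q ^ s.+1)).+1)%N.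
    by case: (size _).
  rewrite (leq_trans (size_sum _ _ _)) //.
  apply/bigmax_leqP => -[[i j] k] _; rewrite (leq_trans (size_scale_leq _ _)) //.
  rewrite size_aux /= ltnS.
  have -> : (q ^ (2 * s + 1) = l * (l * q))%N.
    by rewrite addn1 expnSr mul2n -addnn expnD mulnA.
  rewrite expnSr; have := ltn_ord i; have := ltn_ord j; have := ltn_ord k.
  move: (nat_of_ord i) (nat_of_ord j) (nat_of_ord k) => a b c cq bl al.
  have : (c * d <= q * d)%N by rewrite leq_mul2r ltnW ?orbT.
  have : (b.+1 * q <= (l + d) * q)%N by rewrite leq_mul2r bl orbT.
  move: (l) al l0 q1 => x al x0 qq h1 h2.
  move: h1 h2 qq; move: q => y h1 h2 y1.
  have : (x * (b.+1 * y + c * d) <= x * ((x + d) * y + y * d))%N.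
    by rewrite leq_mul2l leq_add ?orbT.
  have : (x <= x * y)%N by rewrite leq_pmulr // ltnW.
  by clear -al; nia.
move=> m P Pm mn tP.
have [L [z [dL rz zL]]] := exists_residue_field Pm.
have /irreducible_monicsP[mP sP iP] := Pm.
apply: contraT => nPG.
have : coprimep (map_poly (in_alg L) P) (map_poly (in_alg L) (\sum_t u t *: g t)).
  by rewrite coprimep_map irreducible_poly_coprime.
move/coprimep_root => /(_ _ rz) /eqP [].
have evw i : (map_poly (in_alg L) w).[z] ^+ (q ^ i) =
    \sum_(j < s.+1) (map_poly (in_alg L) f).[z] ^+ (q ^ (j + i)).
  rewrite /half_trace rmorph_sum /= horner_sum (expr_sum_card (pchar_lalg L)).
  by apply: eq_bigr => j _; rewrite rmorphXn /= horner_exp -exprM expnD.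
(* The full trace [e] is a sum over [2 * s.+1] conjugates: the first half is the value of [w], the
   second half its [Q]-th power. *)
have wQ : (map_poly (in_alg L) w).[z] ^+ Q = in_alg L e - (map_poly (in_alg L) w).[z].
  have := sum_conjugates_mul Pm dL rz zL f (2 * s.+1 %/ m).
  rewrite divnK // tP mul2n -addnn big_split_ord /= => <-.
  rewrite evw; have := evw 0%N; rewrite expr1 => ->.
  under [X in _ = _ + X - _]eq_bigr => j _ do rewrite addnC.
  under [X in _ = _ - X]eq_bigr => j _ do rewrite addn0.
  by rewrite addrC addKr.
have zQ : z ^+ (Q * Q) = z.
  rewrite -expnD addnn -mul2n -(divnK mn) -{2}dL; exact: expf_card_extM.
have : (map_poly (in_alg L) (\sum_t u t *: g t)).[z] ^+ Q = 0.
  transitivity (map_poly (in_alg L) (\sum_t u t *: h t)).[z]; last first.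
    by rewrite H0 rmorph0 horner0.
  rewrite !rmorph_sum /= !horner_sum (expr_sum_card (pchar_lalg L)).
  apply: eq_bigr => -[[i j] k] _.
  rewrite /h /g !map_polyZ !hornerZ /= exprMn -(rmorphXn (in_alg L)) /= expf_cardX.
  congr (_ * _); rewrite !rmorphM !rmorphXn /= !map_polyX !hornerM !horner_exp hornerX.
  rewrite rmorphB /= map_polyC hornerD hornerN hornerC /= -wQ exprMn -!exprM.
  rewrite (mulnC k) mulnDl -mulnA exprD [in RHS]exprD; congr (_ * _ * _).
  by rewrite mulnC exprM zQ.
by move/eqP; rewrite expf_eq0 => /andP[_ /eqP].
Qed.
End Auxiliary.

(** Distinct irreducible divisors of [G] contribute their degrees to that of [G]; in the
    factorisation formula it is enough to keep the exponent [r = 1]. *)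
Lemma stepanov_count s (e : F) :
  (\sum_(1 <= m < (2 * s.+1).+1 | m %| 2 * s.+1)
     \sum_(P <- irreducible_monics F m |
            weighted_power_sum f P *+ (2 * s.+1 %/ m) == e) m
   <= q ^ (2 * s + 1) + 2 * (d * q ^ s.+1))%N.
Proof.
have [G G0 [sG dG]] := stepanov_auxiliary s e.
pose G1 := (lead_coef G)^-1 *: G.
have lG : lead_coef G != 0 by rewrite lead_coef_eq0.
have sG1 : size G1 = size G by rewrite size_scale // invr_eq0.
have G1m : G1 \in monics F (size G).-1.
  apply/monicsP; rewrite sG1 prednK ?size_poly_gt0 // monicE lead_coefZ mulVf //.
apply: leq_trans sG; set N := maxn (2 * s.+1) (size G).-1.
rewrite (degree_irreducible_factors G1m (leq_maxr (2 * s.+1) _)) -/N.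
rewrite (big_nat_widen _ _ N.+1) ?ltnS ?leq_maxl // big_mkcond /=.
apply: leq_sum => m _; case: ifP => // /andP[mn _].
rewrite big_mkcond big_seq [leqRHS]big_seq /=; apply: leq_sum => P Pm.
case: eqP => // tP; rewrite big_ltn; last by rewrite ltnS /N leq_max.
by rewrite expr1 dvdpZr ?invr_eq0 // (dG m) // mul1n leq_addr.
Qed.
End Stepanov.

(** * Weil's bound *)

Local Notation normc := Normc.normc.

Section ComplexNorm.
Variable R : rcfType.
Implicit Types x y : R[i].

Lemma normc_ge0 x : 0 <= normc x.
Proof. by case: x => a b; exact: sqrtr_ge0. Qed.

Lemma normcD x y : normc (x + y) <= normc x + normc y.
Proof. exact: le_normcD. Qed.

Lemma normc_opp x : normc (- x) = normc x.
Proof. exact: normcN. Qed.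

Lemma normc_sum (I : Type) (r : seq I) (P : pred I) (E : I -> R[i]) :
  normc (\sum_(i <- r | P i) E i) <= \sum_(i <- r | P i) normc (E i).
Proof.
elim/big_ind2 : _ => [|u x v y ux vy|//]; first by rewrite Normc.normc0.
exact: le_trans (normcD _ _) (lerD ux vy).
Qed.

Lemma normcX x n : normc (x ^+ n) = normc x ^+ n.
Proof.
by elim: n => [|n IH]; rewrite ?expr0 ?Normc.normc1 // !exprS Normc.normcM IH.
Qed.

Lemma normc_nat n : normc (n%:R : R[i]) = n%:R.
Proof.
by have := @normcMn R 1 n; rewrite -[1 *+ n]/(n%:R : R[i]) Normc.normc1.
Qed.

Lemma normc_natrB m n N : (m <= n + N)%N -> (n <= m + N)%N ->
  normc (m%:R - n%:R : R[i]) <= N%:R.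
Proof.
move=> mn nm; case/orP: (leq_total m n) => le.
  rewrite -normc_opp opprB -natrB // normc_nat ler_nat; lia.
by rewrite -natrB // normc_nat ler_nat; lia.
Qed.
End ComplexNorm.

(** * Newton's identities, and isolating one number from power sums *)

Section Newton.
Variable C : closedFieldType.
Implicit Types (s : seq C) (N k : nat).

Let E s : {poly C} := \prod_(x <- s) (1 - x *: 'X).
Let S s N : {poly C} := \sum_(j < N) (\sum_(x <- s) x ^+ j.+1) *: 'X^(j.+1).

Lemma geometric_poly (x : C) N :
  (1 - x *: 'X) * \sum_(j < N) x ^+ j.+1 *: 'X^(j.+1) =
  x *: 'X - x ^+ N.+1 *: 'X^(N.+1) :> {poly C}.
Proof.
elim: N => [|N IH]; first by rewrite big_ord0 mulr0 !expr1 subrr.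
rewrite big_ord_recr /= mulrDr IH mulrBl mul1r.
by rewrite -scalerAl -scalerAr scalerA -!exprS addrA subrK.
Qed.

(** For [E s], the product of the [1 - x *: 'X], the series - X E' / E generates the power sums;
    truncating it at [N] only spoils coefficients above [N]. *)
Lemma newton_identity_poly s N k : (k <= N)%N -> ('X * (E s)^`() + E s * S s N)`_k = 0.
Proof.
elim: s k => [|x s IH] k kN.
  rewrite /E /S big_nil derivC mulr0 add0r mul1r coef_sum big1 // => j _.
  by rewrite big_nil scale0r coef0.
have eE : E (x :: s) = (1 - x *: 'X) * E s by rewrite /E big_cons.
have eS : S (x :: s) N = \sum_(j < N) x ^+ j.+1 *: 'X^(j.+1) + S s N.
  by rewrite /S -big_split /=; apply: eq_bigr => j _; rewrite big_cons scalerDl.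
have dx : (1 - x *: 'X)^`() = - x%:P :> {poly C}.
  by rewrite derivB derivZ derivX derivC sub0r -mul_polyC mulr1.
rewrite (_ : _ + _ = (1 - x *: 'X) * ('X * (E s)^`() + E s * S s N)
   + E s * (- x ^+ N.+1 *: 'X^(N.+1))); last first.
  rewrite eE eS derivM dx [_ * (_ + S s N)]mulrDr mulrAC geometric_poly.
  rewrite scaleNr -[x *: 'X]mul_polyC; ring.
rewrite coefD -scalerAr coefZ coefMXn ltnS kN mulr0 addr0.
rewrite mulrBl mul1r coefB IH // sub0r -scalerAl coefZ coefXM.
by case: k kN => [|k] kN /=; rewrite ?mulr0 ?oppr0 // IH ?mulr0 ?oppr0 // ltnW.
Qed.

(** The recurrence determines [sigma] from [a]. By Newton's identities the reciprocal roots of the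
    polynomial with coefficients [a] have, up to sign, power sums obeying the same recurrence. *)
Lemma power_sum_recurrence (a sigma : nat -> C) d : a 0 = 1 ->
  (forall n, (d <= n)%N -> a n = 0) ->
  (forall n, n%:R * a n = \sum_(1 <= j < n.+1) sigma j * a (n - j)%N) ->
  exists2 s : seq C, (size s <= d.-1)%N &
    forall n, (0 < n)%N -> sigma n = - \sum_(x <- s) x ^+ n.
Proof.
move=> a0 ad rec; pose A := \poly_(i < d) a i.
have cA n : A`_n = a n.
  by rewrite coef_poly; case: ltnP => // /ad ->.
have A0 : A != 0 by apply/eqP => /(congr1 (coefp 0)); rewrite /= cA coef0 a0; apply/eqP/oner_neq0.
have [r eA] := closed_field_poly_normal A.
pose s := [seq x^-1 | x <- r].
have eE : A = E s.
  have : \prod_(z <- r) ('X - z%:P) = (\prod_(z <- r) (- z)) *: E s.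
    have : A.[0] != 0 by rewrite horner_coef0 cA a0 oner_neq0.
    rewrite eA hornerZ mulf_eq0 negb_or => /andP[_]; rewrite /E /s big_map.
    elim: (r) => [|z r' IH]; first by rewrite !big_nil scale1r.
    rewrite !big_cons hornerM mulf_eq0 negb_or !hornerE oppr_eq0 => /andP[z0 /IH ->].
    have -> : 'X - z%:P = - z *: (1 - z^-1 *: 'X).
      rewrite scalerBr scalerA mulNr divff // scaleN1r opprK addrC.
      by rewrite -mul_polyC mulr1 rmorphN.
    by rewrite -scalerAl -scalerAr scalerA.
  move=> e; rewrite eA e scalerA; set c := _ * _.
  suff -> : c = 1 by rewrite scale1r.
  have := cA 0; rewrite a0 eA e scalerA -/c -horner_coef0 hornerZ /E horner_prod.
  by rewrite big1 ?mulr1 // => x _; rewrite !hornerE ?mulr0 ?subr0.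
exists s.
  rewrite size_map; have : (size A <= d)%N by rewrite size_poly.
  rewrite eA size_scale ?lead_coef_eq0 // size_prod_XsubC; slia.
have key n : n%:R * a n + \sum_(1 <= j < n.+1) (\sum_(x <- s) x ^+ j) * a (n - j)%N = 0.
  have := @newton_identity_poly s n n (leqnn n); rewrite -eE coefD coefXM.
  apply: etrans; congr (_ + _).
    by case: n => [|n]; rewrite ?mul0r //= coef_deriv cA mulr_natl.
  rewrite /S mulr_sumr coef_sum big_add1 big_mkord; apply: eq_bigr => j _.
  by rewrite -scalerAr coefZ coefMXn ltnNge (ltn_ord j) /= cA.
elim/ltn_ind => n IH n0; have := key n; rewrite rec -big_split /=.
rewrite big_nat_recr //= subnn a0 !mulr1 big1_seq ?add0r => [/eqP|j].
  by rewrite addr_eq0 => /eqP.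
rewrite mem_index_iota => /andP[_ /andP[j0 jn]].
by rewrite (IH j) // mulNr addNr.
Qed.
End Newton.

(** If [x / y = 1 + r] with [r > 0], its powers grow at least linearly by Bernoulli's inequality. *)
Lemma le_of_bounded_powers (R : archiRealFieldType) (x y B : R) : 0 < y ->
  (forall n, x ^+ n.+1 <= B * y ^+ n.+1) -> x <= y.
Proof.
move=> y0 H; rewrite leNgt; apply/negP => yx.
pose r := x / y - 1.
have r0 : 0 < r by rewrite subr_gt0 ltr_pdivlMr // mul1r.
have bern n : 1 + n%:R * r <= (1 + r) ^+ n.
  elim: n => [|n IH]; first by rewrite mul0r addr0.
  rewrite exprS -natr1; have : 0 <= n%:R * r * r by rewrite !mulr_ge0 // ltW.
  have := ler_wpM2l (ltW (ltr_wpDr (ltW r0) ltr01) : 0 <= 1 + r) IH; nra.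
have Hn n : n%:R * r <= B.
  have := H n; rewrite -ler_pdivrMr ?exprn_gt0 // -expr_div_n.
  have -> : x / y = 1 + r by rewrite /r addrC subrK.
  move=> h; apply: le_trans h; apply: le_trans (bern _).
  by rewrite -natr1; have := ltW r0; nra.
have := archi_boundP (le_trans (mulr_ge0 (ler0n _ 0) (ltW r0)) (Hn 0%N) : 0 <= B).
move: (Num.bound B) => m Bm; have [k hk] : exists k : nat, 1 <= k%:R * r.
  have /archi_boundP : 0 <= r^-1 by rewrite invr_ge0 ltW.
  move: (Num.bound _) => k hk; exists k.
  by rewrite -ler_pdivrMr // div1r ltW.
have := Hn (m * k)%N; rewrite natrM -mulrA leNgt => /negP; apply.
by apply: lt_le_trans Bm _; rewrite ler_peMr.
Qed.

(** Even power sums only see squares, so the elements of [s] are grouped by their square; within a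
    group nothing cancels, and its weight is the positive integer [mu]. *)
Lemma norm_le_of_even_power_sums (R : realType) (s : seq R[i]) (q B : R) : 0 < q ->
  (forall n, normc (\sum_(x <- s) x ^+ (2 * n.+1)) <= B * q ^+ n.+1) ->
  forall x, x \in s -> normc x ^+ 2 <= q.
Proof.
move=> q0 H x xs; pose s2 := undup [seq y ^+ 2 | y <- s].
have xs2 : x ^+ 2 \in s2 by rewrite mem_undup; apply/mapP; exists x.
(* Applying [T] to the sequence of power sums isolates the powers of [x ^ 2]. *)
pose T := \prod_(y <- rem (x ^+ 2) s2) ('X - y%:P).
have T0 : T.[x ^+ 2] != 0.
  rewrite -/(root T _) root_prod_XsubC mem_rem_uniq ?undup_uniq // inE eqxx //.
have Ts y : y \in s -> y ^+ 2 != x ^+ 2 -> T.[y ^+ 2] = 0.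
  move=> ys yx; apply/eqP; rewrite -/(root T _) root_prod_XsubC.
  by rewrite mem_rem_uniq ?undup_uniq // inE yx mem_undup; apply/mapP; exists y.
pose mu := count (fun y => y ^+ 2 == x ^+ 2) s.
have mu0 : (0 < mu)%N by rewrite -has_count; apply/hasP; exists x.
have key n : mu%:R * T.[x ^+ 2] * (x ^+ 2) ^+ n.+1 =
    \sum_(k < size T) T`_k * \sum_(y <- s) y ^+ (2 * (n + k).+1).
  under [RHS]eq_bigr => k _ do rewrite mulr_sumr.
  rewrite exchange_big /= (bigID (fun y => y ^+ 2 == x ^+ 2)) /=.
  rewrite [X in _ = _ + X]big_seq_cond [X in _ = _ + X]big1 ?addr0 => [|y /andP[ys yx]].
    transitivity (\sum_(y <- s | y ^+ 2 == x ^+ 2) T.[x ^+ 2] * (x ^+ 2) ^+ n.+1).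
      by rewrite big_const_seq iter_addr_0 -mulrA mulr_natl.
    apply: eq_bigr => y /eqP <-; rewrite horner_coef mulr_suml; apply: eq_bigr => k _.
    by rewrite -mulrA -exprD -exprM addnC addSn.
  transitivity (T.[y ^+ 2] * (y ^+ 2) ^+ n.+1); last by rewrite Ts // mul0r.
  rewrite horner_coef mulr_suml; apply: eq_bigr => k _.
  by rewrite -mulrA -exprD -exprM addnS (addnC n).
rewrite -normcX.
pose K := \sum_(k < size T) normc T`_k * (B * q ^+ k).
have nT0 : 0 < normc T.[x ^+ 2].
  by rewrite lt_def normc_ge0 andbT; apply: contra T0 => /eqP /Normc.eq0_normc ->.
apply: (@le_of_bounded_powers _ _ _ (K / normc T.[x ^+ 2])) => // n.
rewrite mulrAC ler_pdivlMr // -normcX -Normc.normcM.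
apply: (@le_trans _ _ (normc (mu%:R * T.[x ^+ 2] * (x ^+ 2) ^+ n.+1))).
  rewrite -[X in _ <= normc X]mulrA [X in _ <= X]Normc.normcM normc_nat mulrC.
  by rewrite ler_peMl ?normc_ge0 // ler1n.
rewrite key (le_trans (normc_sum _ _ _)) // /K mulr_suml; apply: ler_sum => k _.
rewrite Normc.normcM -mulrA ler_wpM2l ?normc_ge0 // (le_trans (H _)) //.
by rewrite -mulrA -exprD addnS addnC.
Qed.

Section Weil.
Variables (R : realType) (F : finFieldType) (psi : F -> R[i]).
Hypothesis psi0 : psi 0 = 1.
Hypothesis psiD : forall x y, psi (x + y) = psi x * psi y.
Variable x0 : F.
Hypothesis psi_x0 : psi x0 != 1.
Variables (f : {poly F}) (d : nat).
Hypotheses (sf : size f = d.+1) (d0 : (0 < d)%N) (dq : coprime d #|F|).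
Local Notation q := #|F|.

Let q1 : (1 < q)%N := finNzRing_gt1 F.

Lemma psiMn x n : psi (x *+ n) = psi x ^+ n.
Proof. by elim: n => [|n IH]; rewrite ?mulr0n // mulrS exprS psiD IH. Qed.

Lemma sum_psiM x : \sum_c psi (c * x) = if x == 0 then q%:R else 0.
Proof.
case: eqP => [->|/eqP xn0].
  under eq_bigr do rewrite mulr0 psi0.
  by rewrite sumr_const.
pose c0 := x0 / x.
have : \sum_c psi (c * x) = psi x0 * \sum_c psi (c * x).
  rewrite [LHS](reindex_inj (addrI c0)) mulr_sumr; apply: eq_bigr => c _.
  by rewrite mulrDl psiD /c0 divfK.
move/eqP; rewrite -subr_eq0 -{1}[\sum_c _]mul1r -mulrBl mulf_eq0 subr_eq0.
by rewrite eq_sym (negbTE psi_x0) => /eqP.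
Qed.

Let lam c g := psi (c * weighted_power_sum f g).

Let lam1 c : lam c 1 = 1.
Proof. by rewrite /lam weighted_power_sum1 mulr0. Qed.

Let lamM c g h : g \is monic -> h \is monic -> lam c (g * h) = lam c g * lam c h.
Proof. by move=> mg mh; rewrite /lam weighted_power_sumM ?monic_neq0 // mulrDr psiD. Qed.

(** Adding [b *: 'X^(n - d)] permutes the monic polynomials of degree [n] and multiplies [lam c] by
    [psi x0], which is not 1. Such a [b] exists because [dq] makes [d] nonzero in [F]. *)
Lemma monic_sum_eq0 c n : c != 0 -> (d <= n)%N -> monic_sum (lam c) n = 0.
Proof.
move=> c0 dn.
have dF : d%:R != 0 :> F.
  have [p p_pr pF] := finPcharP F; rewrite -(dvdn_pcharf pF).
  apply: contraTN dq => pd; rewrite /coprime.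
  have pq : (p %| q)%N.
    have := card_pprimeChar pF; case: (logn p q) => [|k] e; first by move: q1; rewrite e.
    by rewrite e expnS dvdn_mulr.
  apply/negP => /eqP e; have := dvdn_gcd p d q; rewrite e pd pq dvdn1 => /eqP p1.
  by rewrite p1 in p_pr.
have lf : lead_coef f != 0 by rewrite lead_coef_eq0 -size_poly_eq0 sf.
pose b := - (x0 / (c * lead_coef f * d%:R)).
have perm : perm_eq (monics F n) [seq g + b *: 'X^(n - d) | g <- monics F n].
  have sub g : g \in monics F n -> forall a, g + a *: 'X^(n - d) \in monics F n.
    move=> /monicsP[/monicP mg sg] a; apply/monicsP.
    have sa : (size (a *: 'X^(n - d)) < size g)%N.
      by rewrite sg (leq_ltn_trans (size_scale_leq _ _)) // size_polyXn; lia.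
    by rewrite monicE lead_coefDl // mg size_polyDl.
  apply: uniq_perm => [||g]; first exact: uniq_monics.
    by rewrite map_inj_uniq ?uniq_monics // => ? ? /addIr.
  apply/idP/mapP => [gn|[h hn ->]]; last exact: sub.
  exists (g + (- b) *: 'X^(n - d)); first exact: sub.
  by rewrite scaleNr subrK.
have : monic_sum (lam c) n = psi x0 * monic_sum (lam c) n.
  rewrite {1}/monic_sum (perm_big _ perm) /= big_map mulr_sumr.
  apply: eq_big_seq => g /monicsP[mg sg].
  rewrite /lam (weighted_power_sum_perturb _ sf) // mulrDr psiD mulrC; congr (psi _ * _).
  by rewrite -(mulr_natr b d) /b; field; rewrite c0 lf dF.
move/eqP; rewrite -subr_eq0 -{1}[monic_sum _ _]mul1r -mulrBl mulf_eq0 subr_eq0.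
by rewrite eq_sym (negbTE psi_x0) => /eqP.
Qed.

(** The number of elements of the extension of degree [n] at which [f] takes a value of trace [e];
    an irreducible [P] of degree [m] stands for its [m] roots. *)
Let trace_count e n : nat := (\sum_(1 <= m < n.+1 | m %| n)
   \sum_(P <- irreducible_monics F m | weighted_power_sum f P *+ (n %/ m) == e) m)%N.

(** The trivial character counts all elements of the extension of degree [n]. This is read off the
    recurrence, where [monic_sum] is now [q ^ j]. *)
Lemma point_sum_trivial n : (0 < n)%N -> point_sum (lam 0) n = (q ^ n)%:R.
Proof.
have ms j : monic_sum (lam 0) j = (q ^ j)%:R.
  rewrite /monic_sum /lam; under eq_bigr do rewrite mul0r psi0.
  by rewrite big_const_seq count_predT iter_addr_0 size_monics.
elim/ltn_ind: n => -[//|n] IH _.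
have := monic_sum_recurrence (lam1 0) (lamM 0) n.+1.
rewrite big_nat_recr //= subnn !ms expn0 mulr1.
have -> : \sum_(1 <= j < n.+1) point_sum (lam 0) j * monic_sum (lam 0) (n.+1 - j)
    = n%:R * (q ^ n.+1)%:R.
  transitivity (\sum_(1 <= j < n.+1) ((q ^ n.+1)%:R : R[i])).
    apply: eq_big_nat => j /andP[j0 jn].
    by rewrite IH // ms -natrM -expnD subnKC // ltnW.
  by rewrite sumr_const_nat subn1 mulr_natl.
by rewrite -natr1 mulrDl mul1r => /addrI.
Qed.

Lemma sum_trace_count n : (0 < n)%N -> (\sum_e trace_count e n = q ^ n)%N.
Proof.
move=> n0; apply/eqP; rewrite -(eqr_nat R[i]) -point_sum_trivial //; apply/eqP.
rewrite /trace_count exchange_big natr_sum /point_sum; apply: eq_bigr => m _ /=.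
rewrite (exchange_big_dep predT) //= natr_sum; apply: eq_bigr => P _.
rewrite /lam mul0r psi0 expr1n mulr1.
by rewrite (big_pred1 (weighted_power_sum f P *+ (n %/ m))) // => e; rewrite eq_sym.
Qed.

Lemma sum_point_sum n : \sum_c point_sum (lam c) n = q%:R * (trace_count 0 n)%:R.
Proof.
rewrite /point_sum exchange_big /trace_count natr_sum mulr_sumr; apply: eq_bigr => m _ /=.
rewrite exchange_big natr_sum mulr_sumr [RHS]big_mkcond; apply: eq_bigr => P _ /=.
rewrite -mulr_sumr.
under eq_bigr do rewrite /lam -psiMn -mulrnAr.
by rewrite sum_psiM; case: eqP => _; rewrite ?mulr0 // mulrC.
Qed.

(** The sum is [q] times the number of points of trace 0, minus [q ^ n]. Stepanov's bound at [e = 0]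
    gives the upper estimate; at the [q - 1] other traces it gives the lower one, which accounts for
    the [q ^ 2] in the constant. *)
Lemma norm_sum_point_sum s :
  normc (\sum_(c | c != 0) point_sum (lam c) (2 * s.+1)) <= (2 * d * q ^ 2)%:R * q%:R ^+ s.+1.
Proof.
have n0 : (0 < 2 * s.+1)%N by rewrite muln_gt0.
have /esym/eqP := sum_point_sum (2 * s.+1).
rewrite (bigD1 0) //= point_sum_trivial // addrC -subr_eq => /eqP <-.
have Nb e := stepanov_count sf d0 dq s e.
have := sum_trace_count n0; rewrite (bigD1 0) //=.
have : (\sum_(e : F | e != 0%R) trace_count e (2 * s.+1) <=
    q.-1 * (q ^ (2 * s + 1) + 2 * (d * q ^ s.+1)))%N.
  apply: leq_trans (leq_sum _ (fun e _ => Nb e)) _.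
  by rewrite sum_nat_const cardC1.
have := Nb 0; rewrite -/(trace_count 0 (2 * s.+1)).
have -> : (q ^ (2 * s.+1) = q * q ^ (2 * s + 1))%N.
  by rewrite -expnS; congr (_ ^ _)%N; lia.
rewrite -natrX -!natrM.
move: (trace_count 0 _) (\sum_(e | _) _)%N (q ^ (2 * s + 1))%N (q ^ s.+1)%N => a b X Q.
move: q q1 => y y1 aX bX ab; have [z yz] : exists z, y = z.+1 by exists y.-1; lia.
by apply: normc_natrB; rewrite yz in y1 aX bX ab *; rewrite /= in bX; nia.
Qed.

Theorem weil_bound : normc (\sum_x psi f.[x]) <= (d.-1)%:R * Num.sqrt q%:R.
Proof.
have [S hS] : {S : F -> seq R[i] & forall c, (size (S c) <= d.-1)%N /\
    (c != 0 -> forall n, (0 < n)%N -> point_sum (lam c) n = - \sum_(x <- S c) x ^+ n)}.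
  apply: (@choice _ _ (fun c s => (size s <= d.-1)%N /\
    (c != 0 -> forall n, (0 < n)%N -> point_sum (lam c) n = - \sum_(x <- s) x ^+ n))) => c.
  have [->|c0] := eqVneq c 0; first by exists [::].
  have [|n dn|n|s ss hs] := @power_sum_recurrence _ (monic_sum (lam c)) (point_sum (lam c)) d.
  - exact: monic_sum0.
  - exact: monic_sum_eq0.
  - exact: (monic_sum_recurrence (lam1 c) (lamM c)).
  by exists s.
(* All nontrivial characters are put together since only the sum over them is bounded; each member
   of [T] can still be isolated. *)
pose T := flatten [seq S c | c <- enum (predC1 (0 : F))].
have sT n : (0 < n)%N -> \sum_(x <- T) x ^+ n = - \sum_(c | c != 0) point_sum (lam c) n.
  move=> n0; rewrite big_flatten big_map big_enum_cond /= -sumrN.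
  by apply: eq_big => [c|c]; rewrite !inE andbT // => c0; rewrite (hS c).2 ?opprK.
have q0 : 0 < q%:R :> R by rewrite ltr0n ltnW.
have small c x : c != 0 -> x \in S c -> normc x <= Num.sqrt q%:R.
  move=> c0 xS; rewrite -(ler_pXn2r (n := 2)) ?nnegrE ?normc_ge0 ?sqrtr_ge0 //.
  rewrite sqr_sqrtr ?(ltW q0) //.
  apply: (@norm_le_of_even_power_sums _ T _ (2 * d * q ^ 2)%:R) => // [n|].
    by rewrite sT // normc_opp norm_sum_point_sum.
  by apply/flatten_mapP; exists c; rewrite // mem_enum.
have -> : \sum_x psi f.[x] = point_sum (lam 1) 1.
  rewrite (point_sum1 (lam1 1) (lamM 1)) /monic_sum (perm_big _ (perm_monics1 F)) /=.
  rewrite big_map big_enum; apply: eq_bigr => x _.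
  by rewrite /lam weighted_power_sum_XsubC mul1r.
have [sS eS] := hS 1; rewrite eS ?oner_neq0 // normc_opp.
apply: le_trans (normc_sum _ _ _) _.
apply: (@le_trans _ _ (\sum_(x <- S 1) Num.sqrt q%:R)).
  by rewrite big_seq [leRHS]big_seq; apply: ler_sum => x xS; rewrite expr1 (small 1) ?oner_neq0.
rewrite big_const_seq count_predT iter_addr_0 -[_ *+ size _]mulr_natl.
by rewrite ler_wpM2r ?sqrtr_ge0 // ler_nat.
Qed.
End Weil.

(** * Units modulo M and smooth numbers *)

Section UnitsModulo.
Local Open Scope nat_scope.

(** Chinese remainder theorem: take [x] modulo the part of [n] supported on the primes of [m], and 1
    modulo the rest. *)
Lemma lift_coprime (m n x : nat) : 0 < n -> m %| n -> coprime x m ->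
  exists2 t, coprime t n & t = x %[mod m].
Proof.
move=> n0 mn xm; have m0 : 0 < m by apply: dvdn_gt0 mn.
have cop : coprime n`_(\pi(m)) n`_(\pi(m)^').
  by apply: (@pnat_coprime \pi(m)); apply: part_pnat.
have xn : coprime x n`_(\pi(m)).
  have [x0|x0] := posnP x.
    have m1 : m = 1 by apply/eqP; move: xm; rewrite x0 /coprime gcd0n.
    suff -> : n`_(\pi(m)) = 1 by rewrite coprimen1.
    by apply/eqP; rewrite partn_eq1 // m1; apply/andP; split=> //; apply/allP.
  rewrite coprime_sym; apply: (@pnat_coprime \pi(m)); first exact: part_pnat.
  by rewrite -coprime_pi' // coprime_sym.
exists (chinese n`_(\pi(m)) n`_(\pi(m)^') x 1).
  set c := chinese _ _ _ _; rewrite -[n in coprime _ n](partnC \pi(m) n0) coprimeMr /c.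
  rewrite -coprime_modl chinese_modl // coprime_modl xn /=.
  by rewrite -coprime_modl chinese_modr // coprime_modl coprime1n.
have mp : m %| n`_(\pi(m)) by rewrite -{1}(partn_pi m0) partn_dvd.
by rewrite -(modn_dvdm _ mp) chinese_modl // modn_dvdm.
Qed.

Definition smooth_count M x := count (fun m => \pi(M).-nat m) (iota 1 x).
Definition coprime_count M V := count (fun u => coprime u M) (iota 1 V).

(* Every [n <= V] is the product of its part composed of primes dividing [M],
   which is smooth, and of a factor coprime to [M]. *)
Lemma coprime_count_ge M N V x : 0 < N -> M %| N -> V <= x ->
  V <= smooth_count N x * coprime_count M V.
Proof.
move=> N0 MN Vx; have M0 : 0 < M by apply: dvdn_gt0 MN.
rewrite /smooth_count /coprime_count -!size_filter -(size_allpairs pair).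
rewrite -{1}(size_iota 1 V) -(size_map (fun n => (n`_(\pi(M)), n`_(\pi(M)^')))).
apply: uniq_leq_size => [|_ /mapP[n + ->]].
  rewrite map_inj_in_uniq ?iota_uniq // => a b; rewrite !mem_iota => /andP[a0 _] /andP[b0 _].
  by case=> e1 e2; rewrite -(partnC \pi(M) a0) -(partnC \pi(M) b0) e1 e2.
rewrite mem_iota add1n ltnS => /andP[n0 nV].
have le pi : n`_pi <= V by apply: leq_trans nV; rewrite dvdn_leq // dvdn_part.
apply: allpairs_f; rewrite mem_filter mem_iota part_gt0 add1n ltnS ?le ?andbT.
  rewrite (leq_trans (le _) Vx) andbT.
  by rewrite andbT; apply: (sub_in_pnat _ (part_pnat _ _)) => p _; apply: pi_of_dvd.
by rewrite coprime_sym coprime_pi' // part_pnat.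
Qed.

Lemma modn_cancel c M r s : coprime c M -> c * r = c * s %[mod M] -> r = s %[mod M].
Proof.
move=> cM; wlog sr : r s / s <= r.
  by move=> W; case/orP: (leq_total s r) => sr e; [|apply/esym]; apply: W.
move=> /eqP; rewrite eqn_mod_dvd ?leq_mul // -mulnBr Gauss_dvdr 1?coprime_sym //.
by rewrite -eqn_mod_dvd // => /eqP.
Qed.

(** After division by the common gcd both become units modulo [M']; their quotient, with the inverse
    taken from Euler's theorem, lifts to a unit modulo [M]. *)
Lemma coprime_transitive M y z : 0 < M -> gcdn y M = gcdn z M ->
  exists2 t, coprime t M & t * y = z %[mod M].
Proof.
move=> M0 yz; set d := gcdn z M in yz.
have d0 : 0 < d by rewrite gcdn_gt0 M0 orbT.
have [M' eM] : exists M', M = d * M' by exists (M %/ d); rewrite mulnC divnK // dvdn_gcdr.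
have cop w : gcdn w M = d -> exists2 u, w = d * u & coprime u M'.
  move=> wd; have [u eu] : exists u, w = d * u.
    by exists (w %/ d); rewrite mulnC divnK // -wd dvdn_gcdl.
  exists u => //; apply/eqP; move: wd; rewrite eu eM -muln_gcdr -[RHS]muln1.
  by move/eqP; rewrite eqn_pmul2l // => /eqP.
have [u eu cu] := cop y yz; have [v ev cv] := cop z erefl.
have M'0 : 0 < M' by move: M0; rewrite eM muln_gt0 => /andP[].
have M'M : M' %| M by rewrite eM dvdn_mull.
have vuM' : coprime (v * u ^ (totient M').-1) M' by rewrite coprimeMl cv coprimeXl.
have [t tM et] := lift_coprime M0 M'M vuM'.
exists t => //; rewrite eu ev eM mulnCA -!muln_modr; congr (d * _).
rewrite -modnMml et modnMml -mulnA -expnSr prednK ?totient_gt0 //.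
by rewrite -modnMmr Euler_exp_totient // modnMmr muln1.
Qed.

Variable M : nat.
Hypothesis M0 : 0 < M.
Local Notation units := [set r : 'I_M | coprime r M].
Let N (y z : 'I_M) := #|[set r in units | r * y == z %[mod M]]|.

(** If [a * y' = y] and [b * z = z'] modulo [M], then [r -> b * r * a] carries the solutions for
    [y], [z] injectively to solutions for [y'], [z']. *)
Let N_le (y z y' z' : 'I_M) : gcdn y M = gcdn y' M -> gcdn z M = gcdn z' M -> N y z <= N y' z'.
Proof.
move=> yy zz; have [a aM ea] := coprime_transitive M0 (esym yy).
have [b bM eb] := coprime_transitive M0 zz.
pose phi (r : 'I_M) : 'I_M := Ordinal (ltn_pmod (b * (r * a)) M0).
rewrite /N -(card_imset (f := phi)); last first.
  move=> r s /(congr1 val) /= /(modn_cancel bM); rewrite ![_ * a]mulnC.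
  by move/(modn_cancel aM); rewrite !modn_small // => /val_inj.
apply: subset_leq_card; apply/fintype.subsetP => _ /imsetP[r + ->]; rewrite !inE => /andP[rM /eqP e].
rewrite coprime_modl !coprimeMl bM rM aM /=; apply/eqP.
have e' : r * (a * y') = z %[mod M] by rewrite -modnMmr ea modnMmr.
by rewrite modnMml -!mulnA -modnMmr e' modnMmr eb.
Qed.

Let act (y r : 'I_M) : 'I_M := Ordinal (ltn_pmod (r * y) M0).

Let gcdn_act (y r : 'I_M) : coprime r M -> gcdn (act y r) M = gcdn y M.
Proof. by move=> rM; rewrite /= gcdn_modl gcdnC Gauss_gcdr 1?coprime_sym // gcdnC. Qed.

Let card_act (y : 'I_M) (Q : pred 'I_M) :
  #|[set r in units | Q (act y r)]| = \sum_(z | Q z && (gcdn z M == gcdn y M)) N y z.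
Proof.
rewrite -sum1_card (partition_big (act y) (fun z => Q z && (gcdn z M == gcdn y M))).
  apply: eq_bigr => z /andP[Qz _]; rewrite /N -sum1_card; apply: eq_bigl => r.
  rewrite !inE -(inj_eq val_inj) /= [in RHS](modn_small (ltn_ord z)).
  case: (boolP (_ == _ :> nat)) => [/eqP e|]; rewrite ?andbT ?andbF //.
  have -> : act y r = z by apply: val_inj; rewrite /= e.
  by rewrite Qz andbT.
by move=> r; rewrite !inE => /andP[rM ->] /=; rewrite -[X in gcdn X](erefl (val (act y r))) gcdn_act.
Qed.

Lemma card_gcd_class d : d %| M -> #|[set z : 'I_M | gcdn z M == d]| <= M %/ d.
Proof.
move=> dM; have d0 : 0 < d by apply: dvdn_gt0 dM.
have Md0 : 0 < M %/ d by rewrite divn_gt0 // dvdn_leq.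
pose f (z : 'I_M) : 'I_(M %/ d).-1.+1 := inord (z %/ d).
have -> : M %/ d = #|'I_(M %/ d).-1.+1| by rewrite card_ord prednK.
rewrite -(card_in_imset (f := f)) ?max_card // => z z'.
rewrite !inE => /eqP zd /eqP zd' /(congr1 val); rewrite /f /=.
have lt (w : 'I_M) : w %/ d < (M %/ d).-1.+1 by rewrite prednK // ltn_divLR // divnK.
rewrite !inordK // => e; apply: val_inj.
have dz (w : 'I_M) : gcdn w M = d -> d %| w by move=> <-; apply: dvdn_gcdl.
by rewrite /= -(divnK (dz z zd)) e divnK // dz.
Qed.

(** Any element of a gcd class is carried to any other by the same number [kappa] of units, so [R0]
    is [kappa] times the number of class members in [1, h]. These contain the [d * u] with [u]
    coprime to [M %/ d], hence at least a proportion h / M of the class, up to 2 and the smooth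
    count. *)
Lemma units_average d h : d %| M -> d <= h -> h < M -> exists R0,
  (forall y : 'I_M, gcdn y M = d ->
     #|[set r in units | 1 <= (r * y) %% M <= h]| = R0)
  /\ #|units| * h <= 2 * R0 * M * smooth_count M M.
Proof.
move=> dM dh hM; have d0 : 0 < d by apply: dvdn_gt0 dM.
have dltM : d < M by apply: leq_ltn_trans hM.
pose y0 : 'I_M := Ordinal dltM; have gy0 : gcdn y0 M = d by apply/gcdn_idPl.
pose H := [set z : 'I_M | (1 <= z <= h) && (gcdn z M == d)].
pose O := [set z : 'I_M | gcdn z M == d].
pose kappa := N y0 y0.
have Nk (y z : 'I_M) : gcdn y M = d -> gcdn z M = d -> N y z = kappa.
  by move=> yd zd; apply/eqP; rewrite eqn_leq /kappa !N_le ?yd ?zd.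
exists (kappa * #|H|); split=> [y yd|].
  rewrite (card_act y (fun z => 1 <= z <= h)) yd mulnC -sum_nat_const.
  apply: eq_big => z; first by rewrite inE.
  by move=> /andP[_ /eqP zd]; rewrite Nk.
have -> : #|units| = kappa * #|O|.
  have -> : units = [set r in units | xpredT (act y0 r)].
    by apply/setP => r; rewrite !inE andbT.
  rewrite (card_act y0 xpredT) gy0 mulnC -sum_nat_const.
  by apply: eq_big => z; [rewrite inE | move=> /= /eqP zd; rewrite Nk].
have Md0 : 0 < M %/ d by rewrite divn_gt0 // dvdn_leq.
have cO : #|O| <= M %/ d by apply: card_gcd_class.
have cH : coprime_count (M %/ d) (h %/ d) <= #|H|.
  rewrite /coprime_count -size_filter -(size_map (fun u => insubd y0 (d * u))) cardE.
  have vE u : u \in [seq u <- iota 1 (h %/ d) | coprime u (M %/ d)] ->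
     [/\ d * u <= h, 0 < u, coprime u (M %/ d) & insubd y0 (d * u) = d * u :> nat].
    rewrite mem_filter mem_iota add1n ltnS => /and3P[cu u0 uh].
    have duh : d * u <= h by rewrite mulnC -leq_divRL.
    by split=> //; rewrite val_insubd (leq_ltn_trans duh hM).
  apply: uniq_leq_size => [|_ /mapP[u /vE[duh u0 cu e] ->]].
    rewrite map_inj_in_uniq ?filter_uniq ?iota_uniq // => u v /vE[_ _ _ eu] /vE[_ _ _ ev].
    by move/(congr1 val); rewrite /= eu ev => /eqP; rewrite eqn_pmul2l // => /eqP.
  have gd : gcdn (d * u) M = d.
    by rewrite -{1}(divnK dM) [_ %/ d * d]mulnC -muln_gcdr (eqP cu) muln1.
  by rewrite mem_enum inE e duh muln_gt0 d0 u0 gd /=.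
have Mdd : M %/ d %| M by apply/dvdnP; exists d; rewrite mulnC divnK.
have cc := @coprime_count_ge (M %/ d) M (h %/ d) M M0 Mdd
             (leq_trans (leq_div _ _) (ltnW hM)).
(* The factor 2 pays for the rounding in [h %/ d], which is positive as [d <= h]. *)
have h2 : h <= 2 * (d * (h %/ d)).
  have := divn_eq h d; have := ltn_pmod h d0.
  have : d <= d * (h %/ d) by rewrite leq_pmulr // divn_gt0.
  rewrite [h %/ d * d]mulnC; move: (d * (h %/ d)); lia.
apply: (@leq_trans (kappa * (M %/ d) * (2 * (d * (smooth_count M M * #|H|))))).
  rewrite leq_mul ?leq_mul // (leq_trans h2) // !leq_mul //.
  by rewrite (leq_trans cc) // leq_mul.
move: (smooth_count M M) #|H| => a c; rewrite -[X in _ <= _ * X * _](divnK dM).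
by apply: eq_leq; ring.
Qed.

End UnitsModulo.

Section SmoothNumbers.
Variable R : realType.
Implicit Types (eps : R) (qs : seq nat) (x m n q : nat).

Let smooth qs x := count (fun m => [pred p | p \in qs].-nat m) (iota 1 x).

Let smooth_cons q qs x : (1 < q)%N ->
  (smooth (q :: qs) x <= smooth qs x + smooth (q :: qs) (x %/ q))%N.
Proof.
move=> q1; rewrite /smooth -!size_filter -(size_map (muln q) (seq.filter _ (iota 1 (x %/ q)))) -size_cat.
apply: uniq_leq_size => [|m]; first by rewrite filter_uniq // iota_uniq.
rewrite mem_filter mem_iota add1n ltnS mem_cat => /andP[ms /andP[m0 mx]].
have [/dvdnP[k e]|qm] := boolP (q %| m)%N.
  apply/orP; right; apply/mapP; exists k; last by rewrite mulnC.
  have k0 : (0 < k)%N by move: m0; rewrite e muln_gt0 => /andP[].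
  rewrite mem_filter mem_iota k0 add1n ltnS leq_divRL ?(ltnW q1) // -e mx !andbT.
  by apply: pnat_dvd ms; rewrite e dvdn_mulr.
apply/orP; left; rewrite mem_filter mem_iota m0 add1n ltnS mx !andbT.
move: ms; rewrite /pnat m0 /= => /allP H; apply/allP => p pm.
have := H p pm; rewrite !inE => /orP[/eqP pq|//].
by move: qm; rewrite -pq; move: pm; rewrite mem_primes => /and3P[_ _ ->].
Qed.

(** The Euler factor at [q] of the sum of m^(-eps) over smooth m, as in Rankin's method. *)
Let K eps q : R := (1 - q%:R `^ (- eps))^-1.

Let K_gt0 eps q : 0 < eps -> (1 < q)%N -> 0 < 1 - q%:R `^ (- eps) :> R.
Proof.
move=> e0 q1; rewrite subr_gt0 powRN invf_lt1 ?powR_gt0 ?ltr0n ?(ltnW q1) //.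
have e1 : 1 `^ eps = 1 :> R by rewrite powR1.
by rewrite -[ltLHS]e1 gt0_ltr_powR ?nnegrE // ltr1n.
Qed.

(** Induction on the primes, then on [x]: smooth numbers are split by divisibility by [q], and K = 1
    + q^(-eps) K is the matching identity. *)
Let smooth_le eps qs x : 0 < eps -> {in qs, forall q, (1 < q)%N} ->
  (smooth qs x)%:R <= x%:R `^ eps * \prod_(q <- qs) K eps q.
Proof.
move=> e0; elim: qs x => [|q qs IH] x Hq.
  rewrite big_nil mulr1 /smooth; case: x => [|x]; first by rewrite /= powR_ge0.
  have -> : (count (fun m => [pred p | p \in [::]].-nat m) (iota 1 x.+1) = 1)%N.
    rewrite /= -[RHS]addn0; congr (_ + _)%N; apply/eqP; rewrite -leqn0 leqNgt -has_count.
    apply/hasPn => m; rewrite mem_iota => /andP[m1 _]; apply/negP => /andP[_ /allP H].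
    have := H (pdiv m); rewrite mem_primes pdiv_prime // pdiv_dvd (ltnW m1).
    by move=> /(_ isT).
  by rewrite -[leLHS](powRr0 (x.+1%:R : R)); apply: ler_powR; rewrite ?ler1n // ltW.
have q1 : (1 < q)%N by apply: Hq; rewrite mem_head.
have Hqs : {in qs, forall q, (1 < q)%N} by move=> p pqs; apply: Hq; rewrite inE pqs orbT.
have P0 : 0 <= \prod_(q <- qs) K eps q.
  by rewrite big_seq prodr_ge0 // => p /Hqs p1; rewrite invr_ge0 ltW // K_gt0.
elim/ltn_ind: x => x IHx; case: (posnP x) => [->|x0].
  by rewrite mulr_ge0 ?powR_ge0 // big_cons mulr_ge0 // invr_ge0 ltW // K_gt0.
have lt : (x %/ q < x)%N by rewrite ltn_Pdiv.
have := smooth_cons qs x q1; rewrite -(ler_nat R) natrD => h.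
apply: le_trans h _; apply: le_trans (lerD (IH x Hqs) (IHx _ lt)) _.
rewrite big_cons; set P := \prod_(_ <- _) _ in P0 *.
have h : (x %/ q)%:R `^ eps <= x%:R `^ eps * q%:R `^ (- eps) :> R.
  have -> : q%:R `^ (- eps) = q%:R^-1 `^ eps :> R.
    by rewrite -powR_inv1 ?ler0n // -powRrM mulN1r.
  rewrite -powRM ?invr_ge0 //.
  rewrite ge0_ler_powR ?nnegrE ?divr_ge0 ?(ltW e0) //.
  by rewrite ler_pdivlMr ?ltr0n ?(ltnW q1) // -natrM ler_nat leq_trunc_div.
have Kq : K eps q = 1 + q%:R `^ (- eps) * K eps q.
  have := K_gt0 e0 q1; rewrite /K => k0; field; exact: lt0r_neq0.
rewrite {2}Kq mulrDl mul1r mulrDr lerD2l !mulrA ler_wpM2r //.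
by rewrite ler_wpM2r // invr_ge0 ltW // K_gt0.
Qed.

Let prod_primes_le n : (0 < n)%N -> (\prod_(q <- primes n) q <= n)%N.
Proof.
move=> n0; rewrite {2}(prod_prime_decomp n0) prime_decompE big_map /=.
rewrite big_seq [leqRHS]big_seq; elim/big_ind2: _ => // [a b c d|q qn].
  exact: leq_mul.
by rewrite -{1}(expn1 q) leq_pexp2l ?logn_gt0 // prime_gt0 //; move: qn; rewrite mem_primes => /andP[].
Qed.

(** Half of [eps] is spent on the power of [n], half on the Euler factors: once q^t >= 2, that is
    from [B] on, a factor is at most q^t, and the product of the primes of [m] is at most [m]. The
    primes below [B] contribute a constant. *)
Lemma smooth_count_bound eps : 0 < eps -> exists2 C : R, 0 < C &
  forall m n, (0 < m <= n)%N -> (smooth_count m n)%:R <= C * n%:R `^ eps.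
Proof.
move=> e0; pose t := eps / 2; have t0 : 0 < t by rewrite divr_gt0.
pose B := (Num.truncn ((2 : R) `^ t^-1)).+1.
pose K2 := K t 2.
have K21 : 1 <= K2.
  by rewrite invf_ge1 ?K_gt0 // gerBl powR_ge0.
exists (K2 ^+ B) => [|m n /andP[m0 mn]]; first by rewrite exprn_gt0 // (lt_le_trans ltr01).
have Hq : {in primes m, forall q, (1 < q)%N}.
  by move=> q; rewrite mem_primes => /andP[/prime_gt1].
have -> : smooth_count m n = smooth (primes m) n by [].
apply: le_trans (smooth_le _ t0 Hq) _.
have Kq q : (1 < q)%N -> K t q <= (if (q < B)%N then K2 else 1) * q%:R `^ t.
  move=> q1; have q0 : 0 < q%:R :> R by rewrite ltr0n ltnW.
  case: ltnP => qB.
    apply: (@le_trans _ _ K2); last first.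
      rewrite ler_peMr ?(le_trans ler01) // -[leLHS](powRr0 (q%:R : R)).
      by apply: ler_powR; rewrite ?ler1n ?(ltnW q1) // ltW.
    rewrite lef_pV2 ?posrE ?K_gt0 // lerD2l lerN2 !powRN lef_pV2 ?posrE ?powR_gt0 //.
    by rewrite ge0_ler_powR ?nnegrE ?(ltW t0) ?(ltW q0) // ler_nat.
  have h2 : 2 <= q%:R `^ t :> R.
    have -> : (2 : R) = (2 `^ t^-1) `^ t by rewrite -powRrM mulVf ?gt_eqF // powRr1.
    rewrite ge0_ler_powR ?nnegrE ?powR_ge0 ?(ltW t0) ?(ltW q0) //.
    apply: le_trans (_ : B%:R <= _); last by rewrite ler_nat.
    by rewrite ltW // truncnS_gt.
  rewrite mul1r /K powRN; apply: (le_trans _ h2).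
  rewrite -[leRHS]invrK lef_pV2 ?posrE ?invr_gt0 //; last first.
    by rewrite -powRN K_gt0.
  have : (q%:R `^ t)^-1 <= 2^-1 :> R by rewrite lef_pV2 ?posrE // (lt_le_trans _ h2).
  lra.
have : \prod_(q <- primes m) K t q <= K2 ^+ B * n%:R `^ t.
  apply: (@le_trans _ _ (\prod_(q <- primes m) ((if (q < B)%N then K2 else 1) * q%:R `^ t))).
    rewrite big_seq [leRHS]big_seq; apply: ler_prod => q /Hq q1.
    by rewrite Kq // andbT invr_ge0 ltW // K_gt0.
  rewrite big_split /=; apply: ler_pM.
  - by apply: prodr_ge0 => q _; case: ifP => _; rewrite // (le_trans ler01).
  - by apply: prodr_ge0 => q _; rewrite powR_ge0.
  - rewrite -big_mkcond -big_filter big_const_seq count_predT iter_mulr_1.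
    apply: ler_weXn2l => //; rewrite -[leqRHS](size_iota 0 B); apply: uniq_leq_size.
      by rewrite filter_uniq // primes_uniq.
    by move=> q; rewrite mem_filter mem_iota => /andP[].
  have -> : \prod_(q <- primes m) (q%:R : R) `^ t = (\prod_(q <- primes m) q)%:R `^ t.
    elim: (primes m) => [|q s IH]; first by rewrite !big_nil powR1.
    by rewrite !big_cons natrM powRM // IH.
  by rewrite ge0_ler_powR ?nnegrE ?(ltW t0) // ler_nat (leq_trans (prod_primes_le m0)).
move=> h; apply: le_trans (ler_wpM2l (powR_ge0 _ _) h) _.
rewrite mulrCA -powRD; last by rewrite (gt_eqF (addr_gt0 t0 t0)).
by rewrite /t -splitr.
Qed.

(** This produces the o(1) of the theorem from bounds with arbitrary [eps]: with exponent ln (L n) /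
    ln n the loss is matched exactly. *)
Lemma exists_vanishing_exponent (L : nat -> R) :
  (forall n, (0 < n)%N -> 1 <= L n) ->
  (forall eps, 0 < eps -> exists2 C : R, 0 < C & forall n, (0 < n)%N -> L n <= C * n%:R `^ eps) ->
  exists2 e : nat -> R, (e @ \oo --> (0 : R))%classic &
    forall n, (1 < n)%N -> n%:R `^ e n = L n.
Proof.
move=> L1 HL; exists (fun n => ln (L n) / ln n%:R); last first.
  move=> n n1; have ln0 : ln (n%:R : R) != 0 by rewrite gt_eqF // ln_gt0 // ltr1n.
  by rewrite /powR pnatr_eq0 gtn_eqF ?(ltnW n1) // divfK // lnK // posrE (lt_le_trans ltr01) // L1 // ltnW.
apply/cvgrPdist_le => /= e e0; have e20 : 0 < e / 2 by rewrite divr_gt0.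
have [C C0 HC] := HL _ e20.
near=> n; have n1 : (1 < n)%N by near: n; exact: nbhs_infty_gt.
have n0 := ltnW n1; have ln0 : 0 < ln (n%:R : R) by rewrite ln_gt0 // ltr1n.
have lnL : 0 <= ln (L n) by rewrite ln_ge0 // L1.
rewrite sub0r normrN ger0_norm ?divr_ge0 ?(ltW ln0) // ler_pdivrMr //.
have : ln (L n) <= ln C + e / 2 * ln n%:R.
  rewrite -ln_powR -lnM ?posrE ?powR_gt0 ?ltr0n // ler_ln ?posrE ?mulr_gt0 ?powR_gt0 ?ltr0n //.
    exact: HC.
  exact: lt_le_trans ltr01 (L1 _ n0).
have : ln C <= e / 2 * ln n%:R.
  rewrite -ler_pdivrMl // -[leLHS]expRK ler_ln ?posrE ?expR_gt0 ?ltr0n //.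
  near: n; exact: nbhs_infty_ger.
lra.
Unshelve. all: by end_near.
Qed.
End SmoothNumbers.

(** * Moments of short sums *)

Section Moment.
Variables (R : realType) (F : finFieldType) (psi : F -> R[i]).
Hypothesis psi0 : psi 0 = 1.
Hypothesis psiD : forall x y, psi (x + y) = psi x * psi y.
Hypothesis psiN : forall x, psi (- x) = (psi x)^*%C.
Variable x0 : F.
Hypothesis psi_x0 : psi x0 != 1.
Local Notation q := #|F|.
Hypothesis q_pr : prime q.

Let q0 : (0 < q)%N := prime_gt0 q_pr.

Lemma pchar_natr_eq0 n : (n%:R == 0 :> F) = (q %| n)%N.
Proof.
have qF : q \in [pchar F] by apply: (@card_finPcharP F q 1); rewrite ?expn1.
by rewrite (dvdn_pcharf qF).
Qed.

Lemma normc_psi x : normc (psi x) = 1.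
Proof.
have : psi x * (psi x)^*%C = 1 by rewrite -psiN -psiD subrr psi0.
move/(congr1 (@Normc.normc R)); rewrite Normc.normcM Normc.normc1.
have -> : normc (psi x)^*%C = normc (psi x) by case: (psi x) => a b /=; rewrite sqrrN.
by move/eqP; rewrite -expr2 sqrp_eq1 ?normc_ge0 // => /eqP.
Qed.

(** Omitting [z = 0] costs 1, absorbed by passing from deg f - 1 to deg f in Weil's bound. A
    positive degree below the prime [q] is coprime to it. *)
Lemma sum_psi_nonzero_le (f : {poly F}) H : f != 0 -> f`_0 = 0 ->
  (size f <= H.+1)%N -> (H < q)%N ->
  normc (\sum_(z | z != 0) psi f.[z]) <= H%:R * Num.sqrt q%:R.
Proof.
move=> f0 f00 fH Hq.
have sf : (1 < size f)%N.
  rewrite ltnNge; apply: contra f0 => /size1_polyC ->; by rewrite f00.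
pose d := (size f).-1; have sd : size f = d.+1 by rewrite /d prednK // ltnW.
have d0 : (0 < d)%N by move: sf; rewrite sd.
have dH : (d <= H)%N by move: fH; rewrite sd.
have dq : coprime d q.
  rewrite coprime_sym prime_coprime //; apply/negP => /dvdn_leq.
  by move=> /(_ d0); rewrite leqNgt (leq_ltn_trans dH Hq).
have W := weil_bound psi0 psiD psi_x0 sd d0 dq.
have -> : \sum_(z | z != 0) psi f.[z] = \sum_z psi f.[z] - 1.
  by rewrite [in RHS](bigD1 0) //= horner_coef0 f00 psi0 [RHS]addrAC subrr add0r.
apply: le_trans (normcD _ _) _; rewrite normc_opp Normc.normc1.
have s1 : 1 <= Num.sqrt q%:R :> R.
  by rewrite -[leLHS]sqrtr1 ler_wsqrtr // ler1n.
have : d.-1%:R + 1 <= H%:R :> R by rewrite natr1 prednK // ler_nat.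
move: W s1; move: (normc _) (Num.sqrt _) => u v W s1 dh.
apply: (@le_trans _ _ (d.-1%:R * v + v)); first by rewrite lerD.
rewrite -{2}[v]mul1r -mulrDl ler_wpM2r //; exact: le_trans s1.
Qed.

Variables (I : finType) (U : {set I}) (v : I -> nat) (gam : I -> R[i]).
Variables (a lam g : F) (k D h : nat).
Hypothesis vinj : {in U &, injective v}.
Hypothesis vh : {in U, forall y, (0 < v y <= h)%N}.
Hypothesis gam1 : forall y, normc (gam y) <= 1.
Hypotheses (a0 : a != 0) (kq : (k < q)%N) (D0 : (0 < D)%N) (Dhq : (D * h < q)%N).
Hypotheses (g_prim : q.-1.-primitive_root g) (glam : g ^+ D = lam).

Let T (x : nat) : R[i] := \sum_(y in U) gam y * psi (a * lam ^+ (x * v y)).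
Local Notation S := {ffun 'I_k -> I}.
Let SU := [set s : S | [forall i, s i \in U]].
Let P (s t : S) : {poly F} :=
  \sum_i 'X^(D * v (s i)) - \sum_i 'X^(D * v (t i)).

Let card_SU : #|SU| = (#|U| ^ k)%N.
Proof.
rewrite -[in RHS](card_ord k) -card_ffun_on; apply: eq_card => s.
by rewrite inE; apply/forallP/ffun_onP.
Qed.

Let T_exp x : T x ^+ k =
  \sum_(s in SU) (\prod_i gam (s i)) * psi (a * \sum_i lam ^+ (x * v (s i))).
Proof.
rewrite -[in LHS](card_ord k) -prodr_const /T (bigA_distr_big _ (fun _ y => gam y * psi (a * lam ^+ (x * v y)))).
apply: eq_big => s.
  by rewrite [RHS]inE; apply/idP/forallP => [/ffun_onP //|sU]; exact/ffun_onP.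
move=> _; rewrite big_split /=; congr (_ * _).
rewrite mulr_sumr; elim/big_rec2: _ => [|i y z _ ->]; first by rewrite psi0.
by rewrite psiD.
Qed.

Let T_moment x : real_complex R (normc (T x) ^+ (2 * k)) =
  \sum_(s in SU) \sum_(t in SU) (\prod_i gam (s i)) * (\prod_i gam (t i))^*%C
     * psi (a * (P s t).[g ^+ x]).
Proof.
have -> : real_complex R (normc (T x) ^+ (2 * k)) = T x ^+ k * (T x ^+ k)^*%C.
  rewrite mulnC exprM -normcX; case: (T x ^+ k) => u w /=.
  rewrite sqr_sqrtr ?addr_ge0 ?sqr_ge0 //; simpc; congr Complex; ring.
rewrite {2}T_exp rmorph_sum /= T_exp mulr_suml; apply: eq_bigr => s _.
rewrite [LHS]mulr_sumr; apply: eq_bigr => t _; rewrite rmorphM /= -psiN.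
rewrite mulrACA -psiD; congr (_ * psi _).
rewrite -mulrN -mulrDr /P; congr (_ * _).
rewrite hornerD hornerN !horner_sum; congr (_ - _).
  by apply: eq_bigr => i _; rewrite hornerXn -exprM mulnCA mulnC -glam -exprM mulnC.
by apply: eq_bigr => i _; rewrite hornerXn -exprM mulnCA mulnC -glam -exprM mulnC.
Qed.

Let sum_powers (E : F -> R[i]) : \sum_(x < q.-1) E (g ^+ x) = \sum_(z | z != 0) E z.
Proof.
have g0 : g != 0.
  apply/eqP => g0; have := prim_expr_order g_prim; rewrite g0 expr0n.
  have := prim_order_gt0 g_prim; rewrite lt0n => /negbTE -> /eqP.
  by rewrite eq_sym oner_eq0.
have inj : injective (fun x : 'I_q.-1 => g ^+ x).
  move=> x y /eqP; rewrite (eq_prim_root_expr g_prim) !modn_small // => /eqP.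
  exact: val_inj.
rewrite -(big_map (fun x : 'I_q.-1 => g ^+ x) predT E) -[RHS]big_filter.
apply: perm_big.
have u1 : uniq [seq g ^+ (x : 'I_q.-1) | x <- index_enum 'I_q.-1].
  by rewrite map_inj_uniq // index_enum_uniq.
have u2 : uniq [seq z <- index_enum F | z != 0] by rewrite filter_uniq // index_enum_uniq.
apply: uniq_perm => //.
have sub : {subset [seq g ^+ (x : 'I_q.-1) | x <- index_enum 'I_q.-1] <=
     [seq z <- index_enum F | z != 0]}.
  by move=> _ /mapP[x _ ->]; rewrite mem_filter mem_index_enum expf_neq0.
apply: (uniq_min_size u1 sub _).2.
rewrite -!sum1_size big_filter big_map sum1dep_card cardsE cardC1.
by rewrite sum1_card card_ord.
Qed.

Let P_size s t : s \in SU -> t \in SU -> (size (P s t) <= (D * h).+1)%N.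
Proof.
rewrite !inE => /forallP sU /forallP tU.
have Q (r : S) : (forall i, r i \in U) -> (size (\sum_i 'X^(D * v (r i)) : {poly F})%R <= (D * h).+1)%N.
  move=> rU; rewrite (leq_trans (size_sum _ _ _)) //; apply/bigmax_leqP => i _.
  by rewrite size_polyXn ltnS leq_mul2l; have /andP[_ ->] := vh (rU i); rewrite orbT.
by rewrite (leq_trans (size_polyD _ _)) // size_polyN geq_max !Q.
Qed.

Let P_coef s t n : (P s t)`_n =
  #|[set i | D * v (s i) == n]|%:R - #|[set i | D * v (t i) == n]|%:R.
Proof.
rewrite /P coefB !coef_sum; congr (_ - _).
  rewrite -sum1dep_card natr_sum [RHS]big_mkcond /=; apply: eq_bigr => i _.
  by rewrite coefXn eq_sym; case: eqP.
rewrite -sum1dep_card natr_sum [RHS]big_mkcond /=; apply: eq_bigr => i _.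
by rewrite coefXn eq_sym; case: eqP.
Qed.

Let P_coef0 s t : s \in SU -> t \in SU -> (P s t)`_0 = 0.
Proof.
rewrite !inE => /forallP sU /forallP tU; rewrite P_coef.
have Q (r : S) : (forall i, r i \in U) -> #|[set i | D * v (r i) == 0%N]|%N = 0%N.
  move=> rU; apply: eq_card0 => i; rewrite !inE muln_eq0 !eqn0Ngt D0.
  by have /andP[->] := vh (rU i).
by rewrite !Q // subrr.
Qed.

(** If some [t i] were not among the [s j], the coefficient of [P s t] at its exponent would be
    minus an integer between 1 and [k < q], which is nonzero in [F]. *)
Let P_eq0 s t : s \in SU -> t \in SU -> P s t = 0 ->
  exists c : {ffun 'I_k -> 'I_k}, t = [ffun i => s (c i)].
Proof.
rewrite !inE => /forallP sU /forallP tU P0.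
have ex i : exists j, t i == s j.
  have := P_coef s t (D * v (t i)); rewrite P0 coef0 => /esym/eqP; rewrite subr_eq0.
  have [e|[j]] := set_0Vmem [set j | D * v (s j) == D * v (t i)]%N; last first.
    rewrite inE eqn_pmul2l // => /eqP e _; exists j.
    by apply/eqP/esym/vinj.
  rewrite e cards0 eq_sym pchar_natr_eq0 => /dvdn_leq le.
  have : (0 < #|[set i0 | D * v (t i0) == D * v (t i)]%N|)%N.
    by apply/card_gt0P; exists i; rewrite inE.
  move=> /le; rewrite leqNgt => /negP; case.
  by rewrite (leq_ltn_trans (max_card _)) // card_ord.
exists [ffun i => xchoose (ex i)]; apply/ffunP => i; rewrite !ffunE.
by apply/eqP; exact: xchooseP (ex i).
Qed.

Let card_P_eq0 : (#|[set st in finset.setX SU SU | P st.1 st.2 == 0%R]| <= #|U| ^ k * k ^ k)%N.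
Proof.
have -> : (#|U| ^ k * k ^ k)%N = #|finset.setX SU (finset.setT : {set {ffun 'I_k -> 'I_k}})|.
  by rewrite cardsX card_SU cardsT card_ffun !card_ord.
pose fi (sc : S * {ffun 'I_k -> 'I_k}) : S * S := (sc.1, [ffun i => sc.1 (sc.2 i)]).
apply: (leq_trans _ (leq_imset_card fi _)).
apply: subset_leq_card; apply/fintype.subsetP => -[s t]; rewrite !inE /= -!andbA.
move=> /and3P[sU tU /eqP P0].
have [] := P_eq0 _ _ P0; rewrite ?inE // => c e.
by apply/imsetP; exists (s, c); rewrite ?inE /= ?sU // e.
Qed.

Lemma moment_bound :
  \sum_(x < q.-1) normc (T x) ^+ (2 * k) <=
   (k ^ k)%:R * q%:R * #|U|%:R ^+ k + #|U|%:R ^+ (2 * k) * ((D * h)%:R * Num.sqrt q%:R).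
Proof.
pose B st := if P st.1 st.2 == 0 then q%:R else (D * h)%:R * Num.sqrt q%:R : R.
apply: (@le_trans _ _ (\sum_(st in finset.setX SU SU) B st)).
  have -> : \sum_(x < q.-1) normc (T x) ^+ (2 * k) =
      normc (\sum_(st in finset.setX SU SU) (\prod_i gam (st.1 i)) * (\prod_i gam (st.2 i))^*%C
        * \sum_(x < q.-1) psi (a * (P st.1 st.2).[g ^+ x])).
    have -> : \sum_(st in finset.setX SU SU) (\prod_i gam (st.1 i)) * (\prod_i gam (st.2 i))^*%C
        * \sum_(x < q.-1) psi (a * (P st.1 st.2).[g ^+ x])
        = real_complex R (\sum_(x < q.-1) normc (T x) ^+ (2 * k)).
      rewrite rmorph_sum /=; under [RHS]eq_bigr do rewrite T_moment pair_big_dep.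
      rewrite [RHS]exchange_big /=; apply: eq_big => [[s t]|st _].
        by rewrite inE.
      by rewrite mulr_sumr.
    rewrite /= expr0n /= addr0 sqrtr_sqr ger0_norm // sumr_ge0 // => x _.
    by rewrite exprn_ge0 // normc_ge0.
  apply: le_trans (normc_sum _ _ _) _; apply: ler_sum => -[s t]; rewrite inE /= => /andP[sU tU].
  have gamP (r : S) : normc (\prod_i gam (r i)) <= 1.
    elim/big_rec: _ => [|i y _ y1]; first by rewrite Normc.normc1.
    by rewrite Normc.normcM -[leRHS]mulr1 ler_pM ?normc_ge0.
  have nconj (z : R[i]) : normc z^*%C = normc z by case: z => u w /=; rewrite sqrrN.
  rewrite !Normc.normcM nconj -[leRHS]mul1r ler_pM ?mulr_ge0 ?normc_ge0 //.
    by rewrite -[leRHS]mulr1 ler_pM ?normc_ge0.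
  rewrite /B /=; case: eqP => [->|/eqP P0].
    apply: le_trans (normc_sum _ _ _) _.
    under eq_bigr do rewrite horner0 mulr0 psi0 Normc.normc1.
    by rewrite sumr_const card_ord ler_nat leq_pred.
  rewrite (sum_powers (fun z => psi (a * (P s t).[z]))).
  under eq_bigr do rewrite -hornerZ.
  apply: sum_psi_nonzero_le => //; first by rewrite scaler_eq0 negb_or a0.
    by rewrite coefZ P_coef0 // mulr0.
  by rewrite (leq_trans (size_scale_leq _ _)) // P_size.
rewrite (bigID (fun st => P st.1 st.2 == 0)) /=; apply: lerD.
  apply: (@le_trans _ _ (\sum_(st in [set st in finset.setX SU SU | P st.1 st.2 == 0]) q%:R)).
    rewrite le_eqVlt; apply/orP; left; apply/eqP; apply: eq_big => [st|st /andP[_]].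
      by rewrite !inE.
    by rewrite /B => ->.
  rewrite sumr_const -natrX -!natrM -[_ *+ _]mulr_natr -natrM ler_nat.
  by rewrite [leqLHS]mulnC mulnAC leq_mul2r [(k ^ k * _)%N]mulnC card_P_eq0 orbT.
apply: (@le_trans _ _ (\sum_(st in finset.setX SU SU) (D * h)%:R * Num.sqrt q%:R)).
  rewrite big_mkcondr /=; apply: ler_sum => st _; rewrite /B.
  by case: ifP => [/negbTE ->|] //; rewrite mulr_ge0 ?sqrtr_ge0.
by rewrite sumr_const cardsX card_SU -expnD addnn -mul2n -natrX [leRHS]mulr_natl.
Qed.
End Moment.

(** * The sum over one gcd class *)

Section PowerMean.
Variable R : realFieldType.

Lemma chebyshev_pow (x y : R) n : 0 <= x -> 0 <= y ->
  x * y ^+ n + y * x ^+ n <= x ^+ n.+1 + y ^+ n.+1.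
Proof.
move=> x0 y0; wlog xy : x y x0 y0 / x <= y.
  move=> W; case/orP: (le_total x y) => xy; first exact: W.
  by rewrite addrC [leRHS]addrC W.
have h : x ^+ n <= y ^+ n by rewrite lerXn2r.
by rewrite !exprS; nra.
Qed.

(** Each step of the induction is Chebyshev's sum inequality, obtained by summing [chebyshev_pow]
    over all pairs. *)
Lemma power_mean (I : finType) (A : {set I}) (s : I -> R) n :
  (forall i, 0 <= s i) ->
  (\sum_(i in A) s i) ^+ n.+1 <= #|A|%:R ^+ n * \sum_(i in A) s i ^+ n.+1.
Proof.
move=> s0; elim: n => [|n IH]; first by rewrite expr0 mul1r.
rewrite exprS; apply: le_trans (ler_wpM2l (sumr_ge0 _ (fun i _ => s0 i)) IH) _.
rewrite mulrCA [in leRHS]exprSr -mulrA ler_wpM2l ?exprn_ge0 //.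
suff : 2 * ((\sum_(i in A) s i) * \sum_(i in A) s i ^+ n.+1) <=
       2 * (#|A|%:R * \sum_(i in A) s i ^+ n.+2) by rewrite ler_pM2l.
have e1 : 2 * ((\sum_(i in A) s i) * \sum_(i in A) s i ^+ n.+1) =
    \sum_(i in A) \sum_(j in A) (s i * s j ^+ n.+1 + s j * s i ^+ n.+1).
  rewrite mulr_natl mulr2n {1}mulr_suml [in X in _ + X]mulrC mulr_suml -big_split /=.
  apply: eq_bigr => i _; rewrite !mulr_sumr -big_split /=.
  by apply: eq_bigr => j _; rewrite [s j * _]mulrC.
have e2 : 2 * (#|A|%:R * \sum_(i in A) s i ^+ n.+2) =
    \sum_(i in A) \sum_(j in A) (s i ^+ n.+2 + s j ^+ n.+2).
  under [RHS]eq_bigr do rewrite big_split /= sumr_const.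
  rewrite big_split /= sumr_const sumrMnl.
  by rewrite !mulr_natl mulr2n.
by rewrite e1 e2; do 2 (apply: ler_sum => ? _); apply: chebyshev_pow.
Qed.
End PowerMean.

(** For any primitive root [g0], [lam] is a power of [g0 ^ D] with exponent [u] coprime to [T],
    though perhaps not to [M]; [u] may be changed modulo [T] into a unit modulo [M]. *)
Lemma exists_prim_root_pow (F : finFieldType) T (lam : F) : (T %| #|F|.-1)%N ->
  T.-primitive_root lam -> exists2 g : F, #|F|.-1.-primitive_root g &
    g ^+ (#|F|.-1 %/ T) = lam.
Proof.
set M := #|F|.-1 => TM lamT.
have M0 : (0 < M)%N by rewrite -ltnS prednK ?finNzRing_gt1 // ltnW // finNzRing_gt1.
have qM : #|F| = M.+1 by rewrite prednK // ltnW // finNzRing_gt1.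
have unit (z : F) : z != 0 -> z ^+ M = 1.
  by move=> z0; apply: (mulfI z0); rewrite -exprS -qM expf_card mulr1.
have /hasP[g0 _ g0M] : has M.-primitive_root (enum (predC1 (0 : F))).
  apply: has_prim_root; rewrite ?enum_uniq //.
    by apply/allP => z; rewrite mem_enum unity_rootE => /unit ->.
  by rewrite -cardE cardC1.
have lam0 : lam != 0.
  apply/eqP => l0; have := prim_expr_order lamT; rewrite l0 expr0n.
  by rewrite gtn_eqF ?(prim_order_gt0 lamT) // => /eqP; rewrite eq_sym oner_eq0.
have [[e eM] /= le] := prim_rootP g0M (unit _ lam0).
have g1 := dvdn_prim_root g0M TM; set D := (M %/ T)%N in g1 *.
have DT : (D * T = M)%N by rewrite divnK.
have T0 := prim_order_gt0 lamT.
have /dvdnP[u eu] : (D %| e)%N.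
  rewrite -(dvdn_pmul2r T0) DT (prim_order_dvd g0M) exprM -le.
  by rewrite (prim_expr_order lamT).
have uT : coprime u T.
  rewrite -(prim_root_exp_coprime _ g1) -exprM mulnC -eu -le; exact: lamT.
have [u' u'M u'u] := lift_coprime M0 TM uT.
exists (g0 ^+ u'); first by rewrite prim_root_exp_coprime.
rewrite le eu mulnC -exprM mulnC !exprM.
by apply/eqP; rewrite (eq_prim_root_expr g1) u'u.
Qed.

Section ClassBound.
Variables (R : realType) (F : finFieldType) (psi : F -> R[i]).
Hypothesis psi0 : psi 0 = 1.
Hypothesis psiD : forall x y, psi (x + y) = psi x * psi y.
Hypothesis psiN : forall x, psi (- x) = (psi x)^*%C.
Variable x0 : F.
Hypothesis psi_x0 : psi x0 != 1.
Local Notation q := #|F|.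
Hypothesis q_pr : prime q.
Local Notation M := q.-1.
Variables (a lam : F) (T k d : nat) (X Y : {set 'I_M}) (gam : 'I_M -> R[i]).
Hypotheses (a0 : a != 0) (TM : (T %| M)%N) (lamT : T.-primitive_root lam) (k0 : (0 < k)%N).
Hypothesis gam1 : forall y, normc (gam y) <= 1.
Hypotheses (dM : (d %| M)%N) (Yd : {in Y, forall y : 'I_M, gcdn y M = d}).

Let q2 : (1 < q)%N := prime_gt1 q_pr.
Let M0 : (0 < M)%N. Proof. by rewrite -ltnS prednK // ltnW. Qed.
Let qM : q = M.+1. Proof. by rewrite prednK // ltnW. Qed.
Let D := (M %/ T)%N.

Let lamM : lam ^+ M = 1.
Proof. by rewrite -(divnK TM) mulnC exprM (prim_expr_order lamT) expr1n. Qed.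

Let lam_modn e : lam ^+ (e %% M) = lam ^+ e.
Proof. by rewrite [in RHS](divn_eq e M) exprD mulnC exprM lamM expr1n mul1r. Qed.

Let S (U : {set 'I_M}) (x : nat) : R :=
  normc (\sum_(y in U) gam y * psi (a * lam ^+ (x * y))).

(** Replacing [x] by [r * x] permutes the residues and turns the exponent into [x] times
    [(r * y) %% M], so that only degrees up to [D * h] occur. *)
Lemma shifted_moment (U : {set 'I_M}) h (r : 'I_M) : coprime r M ->
  (k < q)%N -> (D * h < q)%N ->
  {in U, forall y : 'I_M, 0 < (r * y) %% M <= h}%N ->
  \sum_(x < M) S U x ^+ (2 * k) <=
   (k ^ k)%:R * q%:R * #|U|%:R ^+ k + #|U|%:R ^+ (2 * k) * ((D * h)%:R * Num.sqrt q%:R).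
Proof.
move=> rM kq Dhq Uh; have [g gM gD] := exists_prim_root_pow TM lamT.
have D0 : (0 < D)%N by rewrite divn_gt0 ?(prim_order_gt0 lamT) // dvdn_leq.
pose v (y : 'I_M) := ((r * y) %% M)%N.
have vinj : {in U &, injective v}.
  move=> y z _ _ /(modn_cancel rM); rewrite !modn_small // => e; exact: val_inj.
have := moment_bound psi0 psiD psiN psi_x0 q_pr vinj Uh gam1 a0 kq D0 Dhq gM gD.
apply: le_trans; rewrite le_eqVlt; apply/orP; left; apply/eqP.
pose f (x : 'I_M) : 'I_M := Ordinal (ltn_pmod (r * x) M0).
have finj : injective f.
  move=> x y /(congr1 val) /= /(modn_cancel rM); rewrite !modn_small //.
  exact: val_inj.
rewrite (reindex_inj finj); apply: eq_bigr => x _; congr (_ ^+ _).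
rewrite /S; congr normc; apply: eq_bigr => y _; congr (_ * psi (a * _)).
rewrite -lam_modn -[RHS]lam_modn; congr (_ ^+ _).
by rewrite /= /v modnMml modnMmr mulnAC [(x * _)%N]mulnCA mulnAC mulnA.
Qed.

(* These stand for (|Y| T / q^(3/2))^(1/(2k+2)), q^(1/2k) and |X|^(1-1/2k). *)
Variables (nu alpha xi : R).
Hypotheses (nu0 : 0 < nu) (alpha0 : 0 < alpha) (xi0 : 0 <= xi).
Hypotheses (alphaE : alpha ^+ (2 * k) = q%:R)
  (xiE : xi ^+ (2 * k) = #|X|%:R ^+ (2 * k).-1)
  (nuE : nu ^+ (2 * k + 2) * (q%:R * Num.sqrt q%:R) = #|Y|%:R * T%:R).

Let k2 : (0 < 2 * k)%N. Proof. by rewrite muln_gt0. Qed.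
Let q0 : 0 < q%:R :> R. Proof. by rewrite ltr0n ltnW. Qed.
Let sq : Num.sqrt q%:R * Num.sqrt q%:R = q%:R :> R.
Proof. by rewrite -expr2 sqr_sqrtr // ltW. Qed.
Let sq0 : 0 < Num.sqrt q%:R :> R. Proof. by rewrite sqrtr_gt0. Qed.

Let cardM (A : {set 'I_M}) : #|A|%:R <= M%:R :> R.
Proof. by rewrite ler_nat -[leqRHS]card_ord max_card. Qed.

Let Mq : M%:R <= q%:R :> R. Proof. by rewrite ler_nat leq_pred. Qed.

(** Hoelder's inequality, then enlarging [X] to all residues in the moment, then superadditivity of
    the [2 * k]-th power. *)
Lemma norm_sum_le_mean (U : {set 'I_M}) (B C : R) : 0 <= B -> 0 <= C ->
  \sum_(x < M) S U x ^+ (2 * k) <= B ^+ (2 * k) + C ^+ (2 * k) ->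
  \sum_(x in X) S U x <= xi * (B + C).
Proof.
move=> B0 C0 H; have S0 x : 0 <= S U x by apply: normc_ge0.
rewrite -(@ler_pXn2r _ (2 * k)) ?nnegrE ?sumr_ge0 ?mulr_ge0 ?addr_ge0 //.
have := @power_mean R _ X (fun x => S U x) (2 * k).-1 (fun x => S0 x).
rewrite prednK // => /le_trans; apply.
rewrite exprMn xiE ler_wpM2l ?exprn_ge0 //.
apply: (@le_trans _ _ (\sum_(x < M) S U x ^+ (2 * k))).
  rewrite [leRHS](bigID (mem X)) /= lerDl sumr_ge0 // => x _.
  by rewrite exprn_ge0.
apply: le_trans H _; move: k2; case: (2 * k)%N => // n _; elim: n => [|n IH].
  by rewrite !expr1.
rewrite exprS [X in _ + X]exprS [leRHS]exprS.
have : 0 <= B ^+ n.+1 by rewrite exprn_ge0.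
have : 0 <= C ^+ n.+1 by rewrite exprn_ge0.
have : 0 <= (B + C) * ((B + C) ^+ n.+1 - (B ^+ n.+1 + C ^+ n.+1)).
  by apply: mulr_ge0; [rewrite addr_ge0 | rewrite subr_ge0].
nra.
Qed.

Let Psi := smooth_count M M.

Let Psi1 : 1 <= Num.sqrt Psi%:R :> R.
Proof.
rewrite -[leLHS]sqrtr1 ler_wsqrtr // ler1n -has_count; apply/hasP; exists 1%N => //.
by rewrite mem_iota add1n /=; exact: M0.
Qed.

Let X_le : #|X|%:R <= xi * alpha.
Proof.
rewrite -(@ler_pXn2r _ (2 * k)) ?nnegrE ?mulr_ge0 ?(ltW alpha0) //.
rewrite exprMn xiE alphaE -[in leLHS](prednK k2) exprSr ler_wpM2l ?exprn_ge0 //.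
exact: le_trans (cardM X) Mq.
Qed.

Let trivial_bound : \sum_(x in X) S Y x <= xi * alpha * #|Y|%:R.
Proof.
apply: (@le_trans _ _ (\sum_(x in X) #|Y|%:R)).
  apply: ler_sum => x _; apply: le_trans (normc_sum _ _ _) _.
  rewrite -sum1_card natr_sum; apply: ler_sum => y _.
  by rewrite Normc.normcM (normc_psi psi0 psiD psiN) mulr1 gam1.
by rewrite sumr_const -[leLHS]mulr_natl ler_wpM2r.
Qed.

Let sqrtk1 : 1 <= Num.sqrt k%:R :> R.
Proof. by rewrite -[leLHS]sqrtr1 ler_wsqrtr // ler1n. Qed.

Let main_ge0 : 0 <= xi * alpha * #|Y|%:R / nu.
Proof. by rewrite divr_ge0 ?mulr_ge0 // ltW. Qed.

Let T_le : T%:R <= q%:R :> R.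
Proof. by rewrite ler_nat (leq_trans (dvdn_leq M0 TM)) // leq_pred. Qed.

Let nu_pow : nu ^+ (2 * k + 2) <= Num.sqrt q%:R.
Proof.
rewrite -(ler_pM2r (_ : 0 < q%:R * Num.sqrt q%:R)) ?mulr_gt0 // nuE.
rewrite mulrCA sq ler_pM //; exact: le_trans (cardM Y) Mq.
Qed.

Section Large.
Hypothesis knu : k%:R < nu ^+ 2.

Let nu1 : 1 < nu.
Proof.
rewrite -(@ltr_pXn2r _ 2) ?nnegrE ?(ltW nu0) // expr1n (le_lt_trans _ knu) //.
by rewrite ler1n.
Qed.

Let kq : (k < q)%N.
Proof.
rewrite -(ltr_nat R); apply: (lt_le_trans knu).
apply: (@le_trans _ _ (nu ^+ (2 * k + 2))).
  by rewrite ler_weXn2l ?(ltW nu1) // leq_addl.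
apply: (le_trans nu_pow); rewrite -{2}sq ler_peMl ?(ltW sq0) //.
by rewrite -[leLHS]sqrtr1 ler_wsqrtr // ler1n ltnW.
Qed.

Let q_ge3 : (2 < q)%N.
Proof.
rewrite ltn_neqAle q2 andbT; apply/negP => /eqP q2'.
have M1 : M = 1%N by rewrite -q2'.
have Y1 : #|Y|%:R <= 1 :> R by apply: le_trans (cardM Y) _; rewrite M1.
have T1 : T%:R <= 1 :> R by rewrite lern1 (leq_trans (dvdn_leq M0 TM)) // M1.
have : 1 < nu ^+ (2 * k + 2) * (q%:R * Num.sqrt q%:R).
  have s1 : 1 <= Num.sqrt q%:R :> R by rewrite -[leLHS]sqrtr1 ler_wsqrtr // ler1n ltnW.
  rewrite -[ltLHS]mulr1 ltr_pM //; first by rewrite exprn_egt1 // addn2.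
  by apply: (@lt_le_trans _ _ q%:R); rewrite ?ltr1n // ler_peMr ?(ltW q0).
by rewrite nuE ltNge -[leRHS]mulr1 ler_pM.
Qed.

Let M_gt1 : (1 < M)%N. Proof. by rewrite -ltnS prednK // ltnW. Qed.

Let Y_gt0 : 0 < #|Y|%:R :> R.
Proof.
have : 0 < #|Y|%:R * T%:R :> R by rewrite -nuE !mulr_gt0 ?exprn_gt0.
by rewrite !ltr0n -natrM ltr0n muln_gt0 => /andP[].
Qed.

Let T_gt0 : 0 < T%:R :> R.
Proof. by rewrite ltr0n (prim_order_gt0 lamT). Qed.

(** The length at which an average [U r] has about [nu ^+ 2] elements, up to the losses. *)
Let hr : R := nu ^+ 2 * q%:R / #|Y|%:R.
Let h := Num.truncn hr.

Let hr0 : 0 <= hr. Proof. by rewrite divr_ge0 ?mulr_ge0 ?exprn_ge0 ?(ltW nu0). Qed.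

Let h_le : h%:R <= hr. Proof. by have /andP[] := truncn_itv hr0. Qed.

Let d0 : (0 < d)%N. Proof. exact: dvdn_gt0 dM. Qed.

Let Y_le : #|Y|%:R * d%:R <= M%:R :> R.
Proof.
rewrite -natrM ler_nat -leq_divRL //; apply: leq_trans (card_gcd_class M0 dM).
by apply: subset_leq_card; apply/fintype.subsetP => y /Yd; rewrite inE => ->.
Qed.

Let dh : (d <= h)%N.
Proof.
rewrite -ltnS -(ltr_nat R); apply: (@le_lt_trans _ _ hr); last exact: truncnS_gt.
rewrite /hr ler_pdivlMr // mulrC (le_trans Y_le) // (le_trans Mq) // ler_peMl ?(ltW q0) //.
by rewrite exprn_ege1 // ltW.
Qed.

Let hr_le2 : hr <= 2 * h%:R.
Proof.
have : hr < h.+1%:R by exact: truncnS_gt.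
have : 1 <= h%:R :> R by rewrite ler1n (leq_trans d0).
rewrite -natr1; lra.
Qed.

Let DT : D%:R * T%:R = M%:R :> R. Proof. by rewrite -natrM divnK. Qed.

(** Here the equation for [nu] enters: D hr nu^(2k) |Y| T = nu^(2k+2) M q, and this is at most
    nu^(2k+2) q^2 = |Y| T sqrt q. *)
Let Dh_le : (D * h)%:R <= Num.sqrt q%:R / nu ^+ (2 * k) :> R.
Proof.
rewrite natrM; apply: (@le_trans _ _ (D%:R * hr)); first by rewrite ler_wpM2l.
rewrite ler_pdivlMr ?exprn_gt0 //.
rewrite -(ler_pM2r (_ : 0 < #|Y|%:R * T%:R)) ?mulr_gt0 // -{2}nuE.
have -> : D%:R * hr * nu ^+ (2 * k) * (#|Y|%:R * T%:R) =
   nu ^+ (2 * k + 2) * ((D%:R * T%:R) * q%:R).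
  by rewrite /hr exprD; field; exact: lt0r_neq0.
rewrite DT [leRHS]mulrCA ler_wpM2l ?exprn_ge0 ?(ltW nu0) //.
by rewrite [leRHS]mulrCA sq ler_wpM2r // ltW.
Qed.

Let Dh_sqrt : (D * h)%:R <= Num.sqrt q%:R :> R.
Proof.
apply: (le_trans Dh_le); rewrite ler_pdivrMr ?exprn_gt0 // ler_peMr ?(ltW sq0) //.
by rewrite exprn_ege1 // ltW.
Qed.

Let sqrt_lt (n : nat) : n%:R <= Num.sqrt q%:R :> R -> (n ^ 2 <= q)%N.
Proof.
move=> nq; rewrite -(ler_nat R) natrX -[leRHS]sq -expr2.
by rewrite ler_pXn2r ?nnegrE ?(ltW sq0).
Qed.

Let Dhq : (D * h < q)%N.
Proof.
rewrite ltnNge; apply/negP => qn.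
have := leq_trans (leq_mul qn (leq_trans q2 qn)) (sqrt_lt Dh_sqrt).
by rewrite muln2 -addnn -{3}[q]addn0 leq_add2l leqNgt ltnW.
Qed.

Let hM : (h < M)%N.
Proof.
have D0 : (0 < D)%N by rewrite divn_gt0 ?(prim_order_gt0 lamT) // dvdn_leq.
have : (h ^ 2 <= q)%N.
  apply: leq_trans (sqrt_lt Dh_sqrt); rewrite leq_exp2r // leq_pmull //.
rewrite ltnNge => h2; apply/negP => Mh.
have := leq_trans (leq_mul Mh (leq_trans M_gt1 Mh)) (h2 : (h * h <= q)%N).
rewrite muln2 -addnn -[X in (_ <= X)%N](prednK (ltnW q2)) -addn1.
by rewrite leq_add2l leqNgt M_gt1.
Qed.

Let units := [set r : 'I_M | coprime r M].
Let U (r : 'I_M) := [set y in Y | 0 < (r * y) %% M <= h]%N.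

Let E_le : (D * h)%:R * Num.sqrt q%:R <= (alpha / nu) ^+ (2 * k).
Proof.
rewrite expr_div_n alphaE.
have -> : q%:R / nu ^+ (2 * k) = Num.sqrt q%:R * (Num.sqrt q%:R / nu ^+ (2 * k)).
  by rewrite mulrA sq.
by rewrite mulrC ler_wpM2l ?(ltW sq0).
Qed.

Let unit_bound r : r \in units ->
  \sum_(x in X) S (U r) x <=
    xi * (Num.sqrt k%:R * alpha * Num.sqrt #|U r|%:R + #|U r|%:R * (alpha / nu)).
Proof.
rewrite inE => rM.
apply: norm_sum_le_mean; rewrite ?mulr_ge0 ?divr_ge0 ?invr_ge0 ?sqrtr_ge0 ?(ltW alpha0) ?(ltW nu0) //.
apply: le_trans (shifted_moment rM kq Dhq _) _; first by move=> y; rewrite inE => /andP[].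
apply: lerD.
  rewrite !exprMn alphaE !(exprM _ 2) !sqr_sqrtr // natrX.
  by rewrite le_eqVlt eqxx.
by rewrite exprMn ler_wpM2l ?exprn_ge0.
Qed.

(** Each [y] lies in exactly [R0] of the sets [U r], so [R0] times the sum over [Y] is at most the
    total over the units; [unit_bound] is then summed over [r]. *)
Lemma class_bound_large : \sum_(x in X) S Y x <=
  (2 * Num.sqrt k%:R + 1) * Num.sqrt Psi%:R * (xi * alpha * #|Y|%:R / nu).
Proof.
have [R0 [hR0 hG]] := units_average M0 dM dh hM.
have h0 : (0 < h)%N := leq_trans d0 dh.
have G0 : (0 < #|units|)%N.
  by apply/card_gt0P; exists (Ordinal M_gt1); rewrite inE coprime1n.
have R00 : (0 < R0)%N.
  by have : (0 < #|units| * h)%N; [rewrite muln_gt0 G0|move/leq_trans => /(_ _ hG); case: (R0)].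
have Rp : 0 < R0%:R :> R by rewrite ltr0n.
have double x : R0%:R * S Y x <= \sum_(r in units) S (U r) x.
  have -> : R0%:R * S Y x = normc (\sum_(r in units) \sum_(y in U r) gam y * psi (a * lam ^+ (x * y))).
    rewrite /S -[X in X * _](normc_nat R) -Normc.normcM; congr normc.
    rewrite mulr_sumr (exchange_big_dep (mem Y)) /=; last by move=> r y _; rewrite inE => /andP[].
    apply: eq_bigr => y Yy; rewrite -(hR0 y (Yd Yy)) -sum1_card natr_sum mulr_suml.
    by apply: eq_big => [r|r _]; rewrite ?mul1r // !inE Yy.
  exact: normc_sum.
have sumU : \sum_(r in units) #|U r|%:R = R0%:R * #|Y|%:R :> R.
  rewrite -natr_sum -natrM; congr (_%:R).
  under eq_bigr do rewrite -sum1_card.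
  rewrite (exchange_big_dep (mem Y)) /=; last by move=> r y _; rewrite inE => /andP[].
  rewrite mulnC -sum_nat_const; apply: eq_bigr => y Yy.
  rewrite -(hR0 y (Yd Yy)) -sum1_card; apply: eq_bigl => r.
  by rewrite !inE Yy.
(* Cauchy-Schwarz. The count of units is eliminated by [units_average] with [hr <= 2 * h], which
   gives [#|units| * hr <= 4 * R0 * q * Psi], whence the constant 2. *)
have sumsqrt : \sum_(r in units) Num.sqrt #|U r|%:R <=
    2 * Num.sqrt Psi%:R * R0%:R * #|Y|%:R / nu :> R.
  have ge1 : 0 <= \sum_(r in units) Num.sqrt #|U r|%:R :> R.
    by apply: sumr_ge0 => r _; rewrite sqrtr_ge0.
  have ge2 : 0 <= 2 * Num.sqrt Psi%:R * R0%:R * #|Y|%:R / nu.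
    by rewrite divr_ge0 ?mulr_ge0 ?sqrtr_ge0 // ltW.
  rewrite -(@ler_pXn2r _ 2) ?nnegrE //.
  have := @power_mean R _ units (fun r => Num.sqrt #|U r|%:R) 1 (fun r => sqrtr_ge0 _).
  move/le_trans; apply; rewrite expr1.
  under eq_bigr do rewrite sqr_sqrtr //.
  rewrite sumU expr_div_n !exprMn sqr_sqrtr // ler_pdivlMr ?exprn_gt0 //.
  have G : #|units|%:R * h%:R <= 2 * R0%:R * M%:R * Psi%:R :> R by rewrite -!natrM ler_nat.
  have G1 : #|units|%:R * hr <= 4 * R0%:R * q%:R * Psi%:R.
    apply: (@le_trans _ _ (2 * (#|units|%:R * h%:R))).
      by rewrite [leRHS]mulrCA ler_wpM2l.
    apply: (@le_trans _ _ (2 * (2 * R0%:R * M%:R * Psi%:R))); first by rewrite ler_wpM2l.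
    have -> : 2 * (2 * R0%:R * M%:R * Psi%:R) = 4 * R0%:R * Psi%:R * M%:R :> R by ring.
    have -> : 4 * R0%:R * q%:R * Psi%:R = 4 * R0%:R * Psi%:R * q%:R :> R by ring.
    by rewrite ler_wpM2l ?mulr_ge0.
  move: G1; rewrite /hr mulrA ler_pdivrMr // => G1.
  rewrite -(ler_pM2r q0).
  have -> : #|units|%:R * (R0%:R * #|Y|%:R) * nu ^+ 2 * q%:R =
     R0%:R * #|Y|%:R * (#|units|%:R * (nu ^+ 2 * q%:R)) by ring.
  have -> : 2 ^+ 2 * Psi%:R * R0%:R ^+ 2 * #|Y|%:R ^+ 2 * q%:R =
     R0%:R * #|Y|%:R * (4 * R0%:R * q%:R * Psi%:R * #|Y|%:R) :> R by ring.
  by rewrite ler_wpM2l ?mulr_ge0.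
rewrite -(ler_pM2l Rp) mulr_sumr.
apply: (@le_trans _ _ (\sum_(r in units) \sum_(x in X) S (U r) x)).
  by rewrite exchange_big; apply: ler_sum => x _; apply: double.
apply: (le_trans (ler_sum _ unit_bound)).
rewrite -mulr_sumr big_split /= -mulr_sumr -mulr_suml sumU.
apply: (@le_trans _ _ (xi * (Num.sqrt k%:R * alpha * (2 * Num.sqrt Psi%:R * R0%:R * #|Y|%:R / nu)
    + R0%:R * #|Y|%:R * (alpha / nu)))).
  by rewrite ler_wpM2l // lerD2r ler_wpM2l // mulr_ge0 ?sqrtr_ge0 ?(ltW alpha0).
have -> : xi * (Num.sqrt k%:R * alpha * (2 * Num.sqrt Psi%:R * R0%:R * #|Y|%:R / nu)
    + R0%:R * #|Y|%:R * (alpha / nu)) =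
   (2 * Num.sqrt k%:R * Num.sqrt Psi%:R + 1) * (R0%:R * (xi * alpha * #|Y|%:R / nu)).
  by field; exact: lt0r_neq0.
set Z := xi * alpha * #|Y|%:R / nu.
rewrite [leRHS]mulrCA; apply: ler_wpM2r; first by rewrite mulr_ge0.
by rewrite [leRHS]mulrDl mul1r lerD2l.
Qed.
End Large.

(** When [nu ^+ 2 <= k], the trivial bound exceeds the target by at most a factor sqrt k. *)
Lemma class_bound : \sum_(x in X) S Y x <=
  (2 * Num.sqrt k%:R + 1) * Num.sqrt Psi%:R * (xi * alpha * #|Y|%:R / nu).
Proof.
have [knu|nuk] := ltP k%:R (nu ^+ 2); first exact: class_bound_large.
apply: (le_trans trivial_bound).
have nuk' : nu <= Num.sqrt k%:R.
  by rewrite -(@ler_pXn2r _ 2) ?nnegrE ?sqrtr_ge0 ?(ltW nu0) // sqr_sqrtr.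
apply: (@le_trans _ _ (Num.sqrt k%:R * (xi * alpha * #|Y|%:R / nu))).
  rewrite mulrCA ler_peMr ?mulr_ge0 ?(ltW alpha0) //.
  by rewrite ler_pdivlMr // mul1r.
rewrite ler_wpM2r // -[leLHS]mulr1 ler_pM ?sqrtr_ge0 //.
by have := sqrtr_ge0 (k%:R : R); lra.
Qed.
End ClassBound.

(** * The double sum *)

Section AdditiveCharacter.
Variable R : realType.

Lemma e_D m z w : e_ R m (z + w) = e_ R m z * e_ R m w.
Proof.
rewrite /e_ intrD mulrDr mulrDl cosD sinD; simpc; congr Complex.
by rewrite addrC mulrC [X in _ + X]mulrC.
Qed.

Lemma e_0 m : e_ R m 0 = 1.
Proof. by rewrite /e_ mulr0 mul0r cos0 sin0. Qed.

Lemma e_N m z : e_ R m (- z) = (e_ R m z)^*%C.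
Proof. by rewrite /e_ intrN mulrN mulNr cosN sinN. Qed.

Lemma e_mul m z : (0 < m)%N -> e_ R m (m%:Z * z) = 1.
Proof.
move=> m0.
have nat_case n : e_ R m (m%:Z * n%:Z) = 1.
  elim: n => [|n IH]; first by rewrite mulr0 e_0.
  rewrite -addn1 PoszD mulrDr e_D IH mul1r mulr1 /e_.
  rewrite mulfK ?pnatr_eq0 -?lt0n // [2 * pi]mulr_natl.
  by rewrite cos2pi sin2pi.
case: z => n; first exact: nat_case.
by rewrite NegzE mulrN e_N nat_case; congr Complex; rewrite oppr0.
Qed.

Variables (p : nat) (p_pr : prime p).

Definition fp_char (z : 'F_p) : R[i] := e_ R p (nat_of_ord z)%:Z.

Lemma fp_char_int z : e_ R p z = fp_char (z%:~R).
Proof.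
have p0 : p%:Z != 0 by case: (p) (prime_gt0 p_pr).
have := divz_eq z p%:Z; have := modz_ge0 z p0; have := ltz_mod z p0.
case: (z %% p%:Z)%Z => // n; rewrite ger0_norm // ltz_nat => np _ zE.
have -> : z%:~R = n%:R :> 'F_p.
  rewrite {1}zE intrD intrM; have -> : p%:~R = 0 :> 'F_p by exact: pchar_Fp_0.
  by rewrite mulr0 add0r.
by rewrite zE e_D [(z %/ _)%Z * _]mulrC e_mul ?prime_gt0 // mul1r /fp_char val_Fp_nat // modn_small.
Qed.

Lemma fp_charE (z : 'F_p) : ((nat_of_ord z)%:Z)%:~R = z.
Proof. by rewrite -[RHS]natr_Zp. Qed.

Lemma fp_char0 : fp_char 0 = 1.
Proof. by rewrite -[0](mulr0z 1) -fp_char_int e_0. Qed.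

Lemma fp_charD x y : fp_char (x + y) = fp_char x * fp_char y.
Proof. by rewrite -[x]fp_charE -[y]fp_charE -intrD -!fp_char_int e_D. Qed.

Lemma fp_charN x : fp_char (- x) = (fp_char x)^*%C.
Proof. by rewrite -[x]fp_charE -intrN -!fp_char_int e_N. Qed.

(** The value 1 would force sin (pi / p) = 0, but pi / p lies strictly between 0 and pi. *)
Lemma fp_char1 : fp_char 1 != 1.
Proof.
rewrite -[X in fp_char X](mulr1z 1) -fp_char_int /e_ mulr1.
set t : R := 2 * pi / p%:R; apply/eqP => /(congr1 (@complex.Re R)) /=.
pose s : R := pi / p%:R; have -> : t = s + s by rewrite /t /s; field; rewrite pnatr_eq0 -lt0n prime_gt0.
rewrite cosD => c1.
have s0 : 0 < sin s.
  apply: sin_gt0_pi; rewrite divr_gt0 ?pi_gt0 ?ltr0n ?prime_gt0 //=.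
  by rewrite ltr_pdivrMr ?ltr0n ?prime_gt0 // ltr_pMr ?pi_gt0 // ltr1n prime_gt1.
by have := cos2Dsin2 s; nra.
Qed.
End AdditiveCharacter.

Lemma card_divisors_le M : (0 < M)%N ->
  (#|[set d : 'I_M.+1 | d %| M]| <= smooth_count M M)%N.
Proof.
move=> M0; rewrite /smooth_count -size_filter cardE -(size_map val).
apply: uniq_leq_size => [|_ /mapP[d + ->]]; first by rewrite map_inj_uniq ?enum_uniq //; exact: val_inj.
rewrite mem_enum inE => dM; have d0 : (0 < d)%N by apply: dvdn_gt0 dM.
rewrite mem_filter mem_iota add1n ltnS d0 dvdn_leq //= andbT.
by apply: pnat_dvd dM _; apply: pnat_pi.
Qed.

Lemma powR_root (R : realType) (x : R) n : (0 < n)%N -> 0 <= x -> (x `^ (1 / n%:R)) ^+ n = x.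
Proof.
move=> n0 x0; rewrite -powR_mulrn ?powR_ge0 // -powRrM div1r mulVf ?powRr1 //.
by rewrite pnatr_eq0 -lt0n.
Qed.

(* Bounds the number of gcd classes times the loss of [class_bound]. *)
Definition divisor_loss (R : realType) n : R :=
  (maxn 1 (smooth_count n.-1 n.-1))%:R ^+ 2.

Lemma divisor_loss_ge1 (R : realType) n : 1 <= divisor_loss R n.
Proof. by rewrite exprn_ege1 // ler1n leq_max. Qed.

Lemma divisor_loss_bound (R : realType) (eps : R) : 0 < eps ->
  exists2 C : R, 0 < C & forall n, (0 < n)%N -> divisor_loss R n <= C * n%:R `^ eps.
Proof.
move=> e0; have e2 : 0 < eps / 2 by rewrite divr_gt0.
have [C C0 HC] := smooth_count_bound e2.
exists ((1 + C) ^+ 2) => [|n n0]; first by rewrite exprn_gt0 // addr_gt0.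
have -> : n%:R `^ eps = (n%:R `^ (eps / 2)) ^+ 2 :> R.
  by rewrite -powR_mulrn ?powR_ge0 // -powRrM divfK.
rewrite -exprMn lerXn2r ?nnegrE ?mulr_ge0 ?powR_ge0 ?addr_ge0 ?(ltW C0) //.
have n1 : 1 <= n%:R `^ (eps / 2) :> R.
  by rewrite -[leLHS](powRr0 (n%:R : R)); apply: ler_powR; rewrite ?ler1n // ltW.
have h : (smooth_count n.-1 n.-1)%:R <= C * n%:R `^ (eps / 2).
  case: n n0 n1 => [//|[|n]] _ n1; first by rewrite /= mulr_ge0 // ?powR_ge0 // ltW.
  apply: le_trans (HC _ n.+1 _) _; first by rewrite /= leqnn.
  by rewrite ler_wpM2l ?(ltW C0) // ge0_ler_powR ?nnegrE ?(ltW e2) // ler_nat.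
rewrite mulrDl mul1r; case: (leqP 1 (smooth_count n.-1 n.-1)) => _.
  by rewrite (le_trans h) // lerDr (le_trans ler01).
by rewrite (le_trans n1) // lerDl (le_trans _ h).
Qed.

(** This evaluates |Y| / nu; the exponent 3 / (4k + 4) is 3/2 times 1 / (2k + 2), from p^(3/2) in
    the definition of nu. *)
Lemma div_powR_root (R : realType) (y t p : R) k : 0 < y -> 0 < t -> 0 < p ->
  y / (y * t / (p * Num.sqrt p)) `^ (1 / (2 * k + 2)%N%:R) =
  y `^ (1 - 1 / (2 * k + 2)%N%:R) * (p `^ (3 / (4 * k + 4)%N%:R) / t `^ (1 / (2 * k + 2)%N%:R)).
Proof.
move=> y0 t0 p0; set e := 1 / _.
have -> : 3 / (4 * k + 4)%N%:R = (1 + 2^-1) * e :> R.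
  rewrite /e (natrD _ (4 * k)%N 4) (natrD _ (2 * k)%N 2) !natrM; have k0 : 0 <= k%:R :> R by [].
  by field; rewrite !lt0r_neq0 //; lra.
clearbody e; have -> : p * Num.sqrt p = p `^ (1 + 2^-1).
  rewrite powRD; last by rewrite (lt0r_neq0 p0) implybT.
  by rewrite powRr1 ?(ltW p0) // powR12_sqrt // ltW.
have q0 : 0 < p `^ (1 + 2^-1) by rewrite powR_gt0.
rewrite powRM ?mulr_ge0 ?invr_ge0 ?(ltW y0) ?(ltW t0) ?(ltW q0) //.
rewrite powRM ?(ltW y0) ?(ltW t0) // (powRrM p).
have -> : (p `^ (1 + 2^-1))^-1 `^ e = ((p `^ (1 + 2^-1)) `^ e)^-1.
  by rewrite -(powR_inv1 (ltW q0)) -powRrM mulN1r powRN.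
rewrite powRB; last by rewrite (lt0r_neq0 y0) implybT.
rewrite powRr1 ?(ltW y0) //; field.
by rewrite !lt0r_neq0 // powR_gt0.
Qed.

Lemma double_sum_bound (R : realType) (p T k : nat) (lam : 'F_p) (a : int)
    (X Y : {set 'I_p.-1}) (gam : 'I_p.-1 -> R[i]) : (0 < k)%N -> prime p ->
  (T %| p.-1)%N -> T.-primitive_root lam -> coprimez a p%:Z ->
  (forall n, normc (gam n) <= 1) ->
  W a lam gam X Y <= (2 * Num.sqrt k%:R + 1) * (divisor_loss R p *
   (#|X|%:R `^ (1 - 1 / (2 * k)%N%:R) * #|Y|%:R `^ (1 - 1 / (2 * k + 2)%N%:R)
     * p%:R `^ (1 / (2 * k)%N%:R + 3 / (4 * k + 4)%N%:R)
     / T%:R `^ (1 / (2 * k + 2)%N%:R))).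
Proof.
move=> k0 p_pr TM lamT ap gam1.
have cF : #|'F_p| = p by rewrite card_Fp.
have p0 : 0 < p%:R :> R by rewrite ltr0n prime_gt0.
have M0 : (0 < p.-1)%N by rewrite -ltnS prednK ?prime_gt1 ?prime_gt0.
have T0 : (0 < T)%N := prim_order_gt0 lamT.
have a0 : a%:~R != 0 :> 'F_p.
  apply: contraTN ap; rewrite -(dvdz_pcharf (pchar_Fp p_pr)) dvdzE absz_nat => pa.
  by rewrite coprimezE absz_nat coprime_sym prime_coprime // negbK.
pose e : R := 1 / (2 * k + 2)%N%:R.
have e0 : 0 < e by rewrite divr_gt0 // ltr0n addn2.
have e1 : e <= 1 by rewrite ler_pdivrMr ?ltr0n ?addn2 // mul1r ler1n.
pose alpha : R := p%:R `^ (1 / (2 * k)%N%:R).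
pose xi : R := #|X|%:R `^ (1 - 1 / (2 * k)%N%:R).
pose C : R := 2 * Num.sqrt k%:R + 1.
pose Psi := smooth_count p.-1 p.-1.
pose B : R := xi * alpha * (p%:R `^ (3 / (4 * k + 4)%N%:R) / T%:R `^ e).
have B0 : 0 <= B by rewrite !mulr_ge0 ?invr_ge0 ?powR_ge0.
have k2 : (0 < 2 * k)%N by rewrite muln_gt0.
have alphaE : alpha ^+ (2 * k) = p%:R by apply: powR_root.
have xiE : xi ^+ (2 * k) = #|X|%:R ^+ (2 * k).-1.
  rewrite -powR_mulrn ?powR_ge0 // -powRrM mulrBl div1r mul1r mulVf ?pnatr_eq0 -?lt0n //.
  by rewrite -[X in _ - X]/(1%:R) -natrB // subn1 powR_mulrn.
have CB := @class_bound R _ (@fp_char R p) (@fp_char0 R p p_pr) (@fp_charD R p p_pr) (@fp_charN R p p_pr)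
  1 (@fp_char1 R p p_pr).
rewrite cF in CB.
have classB (d : 'I_p.-1.+1) : (d %| p.-1)%N ->
    \sum_(x in X) normc (\sum_(y in [set y in Y | gcdn y p.-1 == d])
      gam y * fp_char R (a%:~R * lam ^+ (x * y))) <=
    C * Num.sqrt Psi%:R * (B * #|Y|%:R `^ (1 - e)).
  move=> dM; set Yd := [set y in Y | _].
  (* The class bound requires [nu > 0], hence a nonempty class. *)
  have [Yd0|[y0 y0Y]] := set_0Vmem Yd.
    rewrite Yd0 big1 ?mulr_ge0 ?addr_ge0 ?sqrtr_ge0 ?powR_ge0 //.
    by move=> x _; rewrite big_set0 Normc.normc0.
  have Y0 : 0 < #|Yd|%:R :> R by rewrite ltr0n; apply/card_gt0P; exists y0.
  pose nu : R := (#|Yd|%:R * T%:R / (p%:R * Num.sqrt p%:R)) `^ e.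
  have psq : 0 < p%:R * Num.sqrt p%:R :> R by rewrite mulr_gt0 ?sqrtr_gt0.
  have YT : 0 < #|Yd|%:R * T%:R / (p%:R * Num.sqrt p%:R) :> R by rewrite divr_gt0 // mulr_gt0 // ltr0n.
  have nu0 : 0 < nu by rewrite powR_gt0.
  have nuE : nu ^+ (2 * k + 2) * (p%:R * Num.sqrt p%:R) = #|Yd|%:R * T%:R.
    by rewrite powR_root ?addn2 // ?(ltW YT) // divfK // lt0r_neq0.
  have Yd' : {in Yd, forall y : 'I_p.-1, gcdn y p.-1 = d}.
    by move=> y; rewrite inE => /andP[_ /eqP].
  have nu_main : nu^-1 * #|Yd|%:R = #|Yd|%:R `^ (1 - e) * (p%:R `^ (3 / (4 * k + 4)%N%:R) / T%:R `^ e).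
    by rewrite mulrC div_powR_root // ltr0n.
  apply: le_trans (CB p_pr _ _ _ _ _ _ _ _ a0 TM lamT k0 gam1 dM Yd' _ _ _ nu0
    (powR_gt0 _ p0) (powR_ge0 _ _) alphaE xiE nuE) _.
  rewrite ler_wpM2l ?mulr_ge0 ?addr_ge0 ?sqrtr_ge0 //.
  rewrite -mulrA [_ / nu]mulrC nu_main /B -/alpha -/xi -[leRHS]mulrA ler_wpM2l ?mulr_ge0 ?powR_ge0 //.
  rewrite [leRHS]mulrC ler_wpM2r ?divr_ge0 ?powR_ge0 //.
  rewrite ge0_ler_powR ?nnegrE ?subr_ge0 // ler_nat; apply: subset_leq_card.
  by apply/fintype.subsetP => y; rewrite inE => /andP[].
have -> : W a lam gam X Y = \sum_(x in X) normc (\sum_(y in Y)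
    gam y * fp_char R (a%:~R * lam ^+ (x * y))).
  apply: eq_bigr => x _; congr normc; apply: eq_bigr => y _; congr (_ * _).
  by rewrite fp_char_int // intrM rmorphXn /= fp_charE.
(* The bound for a class has been stated with all of [Y], so summing over the classes costs the
   number of divisors of [p.-1]. *)
apply: (@le_trans _ _ (\sum_(d : 'I_p.-1.+1 | (d %| p.-1)%N)
    C * Num.sqrt Psi%:R * (B * #|Y|%:R `^ (1 - e)))).
  apply: (@le_trans _ _ (\sum_(d : 'I_p.-1.+1 | (d %| p.-1)%N) \sum_(x in X)
      normc (\sum_(y in [set y in Y | gcdn y p.-1 == d])
         gam y * fp_char R (a%:~R * lam ^+ (x * y))))); last exact: ler_sum.
  rewrite exchange_big /=; apply: ler_sum => x _.
  have gM (y : 'I_p.-1) : (gcdn y p.-1 < p.-1.+1)%N by rewrite ltnS dvdn_leq ?dvdn_gcdr.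
  rewrite (partition_big (fun y : 'I_p.-1 => inord (gcdn y p.-1) : 'I_p.-1.+1)
    (fun d => (d %| p.-1)%N)) /=; last by move=> y _; rewrite inordK ?dvdn_gcdr.
  apply: le_trans (normc_sum _ _ _) _; apply: ler_sum => d _.
  rewrite le_eqVlt; apply/orP; left; apply/eqP; congr normc; apply: eq_bigl => y.
  by rewrite inE -(inj_eq val_inj) /= inordK.
have -> (c : R) : \sum_(d : 'I_p.-1.+1 | (d %| p.-1)%N) c =
    #|[set d : 'I_p.-1.+1 | d %| p.-1]%N|%:R * c.
  by rewrite -sum1dep_card natr_sum mulr_suml; apply: eq_bigr => d _; rewrite mul1r.
have -> : p%:R `^ (1 / (2 * k)%N%:R + 3 / (4 * k + 4)%N%:R) = alpha * p%:R `^ (3 / (4 * k + 4)%N%:R).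
  by rewrite powRD // (lt0r_neq0 p0) implybT.
rewrite -/e -/xi -/C.
have -> : C * (divisor_loss R p * (xi * #|Y|%:R `^ (1 - e) * (alpha * p%:R `^ (3 / (4 * k + 4)%N%:R)) / T%:R `^ e))
   = C * (B * #|Y|%:R `^ (1 - e)) * divisor_loss R p by rewrite /B; ring.
have -> (u v w z : R) : u * (v * w * z) = v * z * (u * w) by ring.
have C0 : 0 <= C by rewrite addr_ge0 ?mulr_ge0 ?sqrtr_ge0.
apply: ler_wpM2l; first by rewrite !mulr_ge0 ?powR_ge0.
rewrite /divisor_loss -/Psi expr2.
have m1 : 1 <= (maxn 1 Psi)%:R :> R by rewrite ler1n leq_max.
have mP : Psi%:R <= (maxn 1 Psi)%:R :> R by rewrite ler_nat leq_maxr.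
apply: ler_pM => //; rewrite ?sqrtr_ge0 //.
  by apply: le_trans mP; rewrite ler_nat card_divisors_le.
rewrite -(@ler_pXn2r _ 2) ?nnegrE ?sqrtr_ge0 // sqr_sqrtr //.
by apply: (le_trans mP); rewrite expr2 ler_peMr.
Qed.

Local Open Scope classical_set_scope.

Theorem theorem1 (R : realType) (k : nat) (hk : (0 < k)%N) :
  exists (c : R) (eps : nat -> R),
    [/\ 0 < c,
        eps @ \oo --> (0 : R) &
        forall (p T : nat) (lambda : 'F_p) (a : int)
               (X Y : {set 'I_p.-1}) (gamma : 'I_p.-1 -> R[i]),
          prime p ->
          (0 < T)%N ->
          (T %| p.-1)%N ->
          T.-primitive_root lambda ->
          coprimez a p%:Z ->
          (forall n : 'I_p.-1, Normc.normc (gamma n) <= 1) ->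
          W a lambda gamma X Y <=
            c * (#|X|%:R `^ (1 - 1 / (2 * k)%N%:R)
                 * #|Y|%:R `^ (1 - 1 / (2 * k + 2)%N%:R)
                 * p%:R `^ (1 / (2 * k)%N%:R + 3 / (4 * k + 4)%N%:R + eps p)
                 / T%:R `^ (1 / (2 * k + 2)%N%:R))].
Proof.
have [eps eps0 epsE] := exists_vanishing_exponent (fun n _ => divisor_loss_ge1 R n)
  (@divisor_loss_bound R).
exists (2 * Num.sqrt k%:R + 1), eps; split=> //.
move=> p T lam a X Y gam p_pr _ TM lamT ap gam1.
apply: le_trans (double_sum_bound X Y hk p_pr TM lamT ap gam1) _.
rewrite [p%:R `^ (_ + eps p)]powRD; last first.
  by rewrite pnatr_eq0 -lt0n prime_gt0 // implybT.
rewrite epsE ?prime_gt1 // le_eqVlt; apply/orP; left; apply/eqP; ring.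
Qed.
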